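(* Let $s>0$, $s\neq1$, and $a\ge b>0$, and let $L_{(s)}(a,b)$ denote the perimeter of the superellipse $\mathscr{C}_s(a,b)$. Then $L_{(s)}(a,b)=L_{(s)}(b,a)$, and the perimeter admits the symmetric representation $L_{(s)}(a,b)=L^{+}_{(s)}$ for $s>1$ and $L_{(s)}(a,b)=L^{-}_{(s)}$ for $0<s<1$ (the latter in the Abel-regularized sense), where $$L_{(s)}^{\pm}=\frac{2\sqrt{a^2+b^2}}{\pm(s-1)}\sum_{k=0}^{\infty}\frac{(-1)^k(\alpha)_k}{k!\,u_k^{\pm}}\left[{}_2F_1\left(-\tfrac12,1;u_k^{\pm}+1;\tfrac{b^2}{a^2+b^2}\right)+{}_2F_1\left(-\tfrac12,1;u_k^{\pm}+1;\tfrac{a^2}{a^2+b^2}\right)\right],$$ the upper sign corresponding to $s>1$ and the lower sign to $0<s<1$, with $\alpha=1+\frac1s$, $u_k^{+}=\frac{sk+1}{2(s-1)}$ and $u_k^{-}=\frac{s(k+1)}{2(1-s)}$. Moreover, $$0<\frac{b^2}{a^2+b^2}\le\frac12\le\frac{a^2}{a^2+b^2}<1;$$ hence, for each fixed $k$, the hypergeometric factors in this representation are represented by absolutely convergent Gauss series.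
   Context: For $a,b,s>0$, the superellipse (Lamé curve) $\mathscr{C}_s(a,b)$ is the closed plane curve given in polar coordinates by $r=r_{a,b}(\theta)=\left(\frac{|\cos\theta|^s}{a^s}+\frac{|\sin\theta|^s}{b^s}\right)^{-1/s}$, $0\le\theta<2\pi$. Its perimeter is its total arc length. $(q)_k=\Gamma(q+k)/\Gamma(q)$ is the Pochhammer symbol. ${}_2F_1(A,B;C;z)$ is the Gauss hypergeometric function and its Gauss series is $\sum_n\frac{(A)_n(B)_n}{(C)_n}\frac{z^n}{n!}$. Abel-regularized sense: an infinite series $\sum_k c_k$ is replaced by $\lim_{\varepsilon\to1^-}\sum_k c_k\varepsilon^k$, $0<\varepsilon<1$ (that is, $(-1)^k$ is replaced by $(-\varepsilon)^k$ and then $\varepsilon\to1^-$). *)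

(* Defs.v *)
From HB Require Import structures.
From mathcomp Require Import all_boot all_order all_algebra.
From mathcomp Require Import all_classical all_reals all_analysis.

Set Implicit Arguments.
Unset Strict Implicit.
Unset Printing Implicit Defensive.

Import Order.TTheory GRing.Theory Num.Theory.
Import numFieldNormedType.Exports.

Local Open Scope classical_set_scope.
Local Open Scope ring_scope.

(* Arc length of a plane curve on [x, y]: supremum of the lengths of the
   inscribed polygons. The Euclidean distance is written out because the
   library norm on R * R is the max norm. *)

Definition euclid_dist (R : realType) (p q : R * R) : R :=
  Num.sqrt ((p.1 - q.1) ^+ 2 + (p.2 - q.2) ^+ 2).

Definition polygon_length (R : realType) (c : R -> R * R) (x y : R)
    (t : seq R) : R :=
  \sum_(0 <= i < size t)
    euclid_dist (c (nth y t i)) (c (nth y (x :: t) i)).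

Definition arc_length (R : realType) (c : R -> R * R) (x y : R) : \bar R :=
  ereal_sup [set (polygon_length c x y t)%:E | t in itv_partition x y].

Definition superellipse_radius (R : realType) (s a b theta : R) : R :=
  (`|cos theta| `^ s / a `^ s + `|sin theta| `^ s / b `^ s) `^ (- s^-1).

Definition superellipse (R : realType) (s a b theta : R) : R * R :=
  (superellipse_radius s a b theta * cos theta,
   superellipse_radius s a b theta * sin theta).

(* theta = 2 * pi only closes the curve up: it is traversed once. *)
Definition perimeter (R : realType) (s a b : R) : \bar R :=
  arc_length (superellipse s a b) 0 (2 * pi).

(* Euler's integral, for 0 < x *)
Definition euler_gamma (R : realType) (x : R) : R :=
  \int[lebesgue_measure]_(t in `]0, +oo[) (t `^ (x - 1) * expR (- t)).

(* Extension of Euler's integral by Gamma x = Gamma (x + 1) / x, iterated m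
   times where m is the least number such that 0 < x + m. At the poles
   0, -1, -2, ... a factor of the denominator vanishes and the value is 0. *)
Definition Gamma (R : realType) (x : R) : R :=
  let m := if 0 < x then 0%N else (Num.truncn (- x)).+1 in
  euler_gamma (x + m%:R) / \prod_(i < m) (x + i%:R).

Definition pochhammer (R : realType) (q : R) (k : nat) : R :=
  Gamma (q + k%:R) / Gamma q.

Definition gauss_term (R : realType) (A B C z : R) (n : nat) : R :=
  pochhammer A n * pochhammer B n / pochhammer C n * (z ^+ n / n`!%:R).

(* The principal value of 2F1 for |z| < 1, where it is the sum of its Gauss
   series; no other argument is used here. *)
Definition hyp2F1 (R : realType) (A B C z : R) : R :=
  limn (series (gauss_term A B C z)).

Definition abs_cvg_gauss_series (R : realType) (A B C z : R) : Prop :=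
  cvgn [normed series (gauss_term A B C z)] /\
  series (gauss_term A B C z) @ \oo --> hyp2F1 A B C z.

Definition abel_summable (R : realType) (c : nat -> R) : Prop :=
  (forall e : R, 0 < e < 1 -> cvgn (series (fun k => c k * e ^+ k))) /\
  cvg ((fun e : R => limn (series (fun k => c k * e ^+ k))) @ (1 : R)^'-).

Definition abel_sum (R : realType) (c : nat -> R) : R :=
  lim ((fun e : R => limn (series (fun k => c k * e ^+ k))) @ (1 : R)^'-).

Definition u_plus (R : realType) (s : R) (k : nat) : R :=
  (s * k%:R + 1) / (2 * (s - 1)).

Definition u_minus (R : realType) (s : R) (k : nat) : R :=
  s * k.+1%:R / (2 * (1 - s)).

Definition perimeter_term (R : realType) (u : nat -> R) (s a b : R)
    (k : nat) : R :=
  (-1) ^+ k * pochhammer (1 + s^-1) k / (k`!%:R * u k) *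
  (hyp2F1 (- 2^-1) 1 (u k + 1) (b ^+ 2 / (a ^+ 2 + b ^+ 2)) +
   hyp2F1 (- 2^-1) 1 (u k + 1) (a ^+ 2 / (a ^+ 2 + b ^+ 2))).

Definition L_plus (R : realType) (s a b : R) : R :=
  2 * Num.sqrt (a ^+ 2 + b ^+ 2) / (s - 1) *
  limn (series (perimeter_term (u_plus s) s a b)).

Definition L_minus (R : realType) (s a b : R) : R :=
  2 * Num.sqrt (a ^+ 2 + b ^+ 2) / (- (s - 1)) *
  abel_sum (perimeter_term (u_minus s) s a b).

(* Main.v *)
(* For a, b > 0 put v = ((a / b) tan theta)^s. The arc of the superellipse from
   the x-axis to the ray of slope b / a becomes
     v |-> (a (1 + v)^(-1/s), b (v / (1 + v))^(1/s)),  0 <= v <= 1,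
   with speed (1/s) (1 + v)^(-alpha) sqrt (a^2 + b^2 v^(2/s - 2)), where
   alpha = 1 + 1/s, and by symmetry the perimeter is four times the sum of the
   lengths of the arcs of (a, b) and (b, a). Expanding (1 + v)^(-alpha) in powers
   of v leaves moments of v^(m - 1) sqrt (A + B v^w) on [0, 1]; integrating by
   parts repeatedly, with x = v^w and u = m / w, gives
     sqrt (A + B) / m * 2F1 (-1/2, 1; u + 1; B / (A + B)).
   No integral of the speed is needed: a function whose derivative dominates
   (is dominated by) the speed bounds the arc length from above (below), and the
   truncated expansions are explicit primitives up to a controlled error. The
   binomial remainder is at most (alpha)_n / n! v^n, which after integration
   costs O((alpha)_n / (n! (n + 1/s))), and this tends to 0 when s > 1. When
   s < 1, v is first replaced by e v in the binomial series, at a cost O(1 - e)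
   uniform in n. *)

Require Import Defs.
From HB Require Import structures.
From mathcomp Require Import all_boot all_order all_algebra.
From mathcomp Require Import all_classical all_reals all_analysis.
From mathcomp Require Import measurable_realfun ring lra.

Import Order.TTheory GRing.Theory Num.Theory.
Import numFieldNormedType.Exports.

Local Open Scope classical_set_scope.
Local Open Scope ring_scope.

Set Implicit Arguments.
Unset Strict Implicit.

(** * Euler's Gamma function and Pochhammer symbols *)

(** The arc stops at the ray of slope [b / a] because [v = 1] there, the end of the interval on
    which the binomial series can be used; beyond it the parameter is [1 / v], which exchanges [a]
    and [b]. For [s > 1] the exponent [2/s - 2] under the root is negative; taking [v^(1/s - 1)] out
    makes it positive and swaps the roles of [a] and [b]. Hence [m = k + 1/s], [w = 2 - 2/s] in that
    case and [m = k + 1], [w = 2/s - 2] in the other, and the quotients [m / w] are the two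
    sequences [u_k]. Expanding the root in powers of [B / A] would require [B <= A], which fails for
    one of the two arcs unless [a = b]; integration by parts takes its boundary terms at [v = 1],
    where the radicand is [A + B], so the variable is [B / (A + B) < 1] for both. For [s < 1] the
    terms of the series grow like [k^(1/s - 1)] in absolute value, so that only Abel summation is
    left. One estimate with parameters [e] and [n] serves both cases: [e = 1] for [s > 1]; for
    [s < 1], [n] goes to infinity before [e] goes to 1. *)

Section gamma.
Context {R : realType}.
Implicit Types x t : R.
Local Notation mu := lebesgue_measure.

Let h x t : R := t `^ (x - 1) * expR (- t).
Let E x : \bar R := (\int[mu]_(t in `]0%R, +oo[) (h x t)%:E)%E.
(** Compact intervals exhausting the open half-line, on which integration by parts meets no singular
    endpoint. Starting from 2 keeps the endpoints distinct for every [n]. *)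
Let J n : set R := `[n.+2%:R^-1, n.+2%:R]%classic.

Let h_ge0 x t : 0 <= h x t. Proof. by rewrite mulr_ge0 ?powR_ge0 ?expR_ge0. Qed.

Let measurable_h (D : set R) x : measurable_fun D (fun t : R => (h x t)%:E).
Proof.
apply: measurable_funTS; apply/measurable_EFinP; apply: measurable_funM.
  exact: measurable_powR.
by apply: measurableT_comp => //; exact: measurableT_comp.
Qed.

Let J_cvg x : ((\int[mu]_(t in J n) (h x t)%:E) @[n --> \oo] --> E x)%E.
Proof.
have -> : E x = (\int[mu]_(t in \bigcup_n J n) (h x t)%:E)%E.
  congr (integral _ _ _); apply/seteqP; split=> t.
    rewrite /= in_itv/= andbT => t0.
    exists (Num.truncn (t + t^-1)).+1 => //=.
    have ub : t + t^-1 <= (Num.truncn (t + t^-1)).+3%:R.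
      have := truncnS_gt (t + t^-1).
      by move=> /ltW/le_trans; apply; rewrite ler_nat (leq_addl 2).
    have tV : 0 < t^-1 by rewrite invr_gt0.
    rewrite /J /= in_itv/=; apply/andP; split; last lra.
    by rewrite -[leRHS]invrK lef_pV2 ?posrE//; lra.
  move=> [n _]; rewrite /J /= !in_itv/= andbT => /andP[h1 _].
  by rewrite (lt_le_trans _ h1)// invr_gt0.
apply: ge0_nondecreasing_set_cvg_integral => //.
- apply/nondecreasing_seqP => n; apply/subsetPset; apply/subset_itv; rewrite bnd_simp.
    by rewrite lef_pV2 ?posrE// ler_nat.
  by rewrite ler_nat.
- by move=> n; rewrite /J; exact: measurable_itv.
- by move=> n; exact: (measurable_h (D := J n)).
- by move=> n t Jt; rewrite lee_fin h_ge0.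
Qed.

(** Raising [t / (x + 1) <= expR (t / (x + 1))] to the power [x + 1] bounds t^(x + 1) exp(-t) by (x
    + 1)^(x + 1). This removes the boundary term at infinity in [gammaE_rec]. *)
Lemma powR_expRN_le x t : 0 < x -> 0 < t ->
  t `^ x * expR (- t) <= (x + 1) `^ (x + 1) / t.
Proof.
move=> x0 t0; have x10 : 0 < x + 1 by lra.
rewrite ler_pdivlMr// mulrAC (mulrC _ t) -{1}(addrK 1 x) mulr_powRB1 ?(ltW t0)//.
rewrite expRN ler_pdivrMr ?expR_gt0//.
have -> : expR t = expR (t / (x + 1)) `^ (x + 1).
  by rewrite -expRM mulfVK// gt_eqF.
rewrite -powRM ?expR_ge0 ?(ltW x10)//.
apply: ge0_ler_powR; rewrite ?nnegrE ?mulr_ge0 ?expR_ge0 ?(ltW x10) ?(ltW t0)//.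
rewrite -ler_pdivrMl//; apply: le_trans (expR_ge1Dx _); rewrite mulrC lerDr.
exact: ler01.
Qed.

Let by_parts x n : 0 < x ->
  (\int[mu]_(t in J n) (h (x + 1) t)%:E =
   (n.+2%:R^-1 `^ x * expR (- n.+2%:R^-1) - n.+2%:R `^ x * expR (- n.+2%:R))%:E +
   x%:E * \int[mu]_(t in J n) (h x t)%:E)%E.
Proof.
move=> x0; set b : R := n.+2%:R.
have b1 : 1 < b by rewrite ltr1n.
have b0 : 0 < b by rewrite ltr0n.
have ab : b^-1 < b by apply: (lt_trans _ b1); rewrite invf_lt1.
have a0 : 0 < b^-1 by rewrite invr_gt0.
have Jgt0 t : t \in `[b^-1, b] -> 0 < t.
  by rewrite in_itv/= => /andP[+ _]; exact: lt_le_trans.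
have Jpos t : `[b^-1, b]%classic t -> 0 < t by move=> /Jgt0.
have dpow t : 0 < t -> derivable (@powR R ^~ x) t 1.
  by move=> t0; apply: derivable_powR; rewrite in_itv/= t0.
have cpow t : 0 < t -> {for t, continuous (@powR R ^~ x)}.
  by move=> t0; apply/differentiable_continuous/derivable1_diffP/dpow.
have cexp t : {for t, continuous (fun t : R => expR (- t))}.
  by apply: continuous_comp; [exact: opp_continuous|exact: continuous_expR].
have dexp (t : R) : is_derive t 1 (fun t : R => - expR (- t)) (expR (- t)).
  have := is_deriveN (is_derive1_comp (is_derive_expR (- t)) (is_deriveNid t 1)).
  by rewrite mulrN1 opprK.
transitivity (\int[mu]_(t in J n) (t `^ x * expR (- t))%:E)%E.
  by apply: eq_integral => t _; rewrite /h addrK.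
rewrite (@integration_by_parts _ (@powR R ^~ x) (fun t => - expR (- t))
  (fun t => x * t `^ (x - 1)) (fun t => expR (- t)))//.
- rewrite -/b; congr ((_)%:E + _)%E; first by rewrite !mulrN opprK addrC.
  rewrite -ge0_integralZl_EFin//; last 3 first.
    by move=> t _; rewrite lee_fin h_ge0.
    exact: measurable_h.
    exact: ltW.
  rewrite -[RHS]oppeK -integral_ge0N; last first.
    by move=> t _; rewrite -EFinM lee_fin mulr_ge0 ?h_ge0 ?ltW.
  by congr (- _)%E; apply: eq_integral => t _; rewrite -EFinM -EFinN /h mulrN mulrA.
- by rewrite /J; exact: measurable_itv.
- apply: derivable_within_continuous => t /Jgt0 t0.
  by apply: derivableM => //; apply: derivable_powR; rewrite in_itv/= t0.
- split.
  + by move=> t /subset_itv_oo_cc /Jgt0; exact: dpow.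
  + by apply/cvg_at_right_filter/cpow.
  + by apply/cvg_at_left_filter/cpow.
- by move=> t /subset_itv_oo_cc /Jgt0 t0; rewrite powR_derive1// in_itv/= t0.
- by apply: continuous_subspaceT => t; exact: cexp.
- split.
  + by move=> t _; exact: ex_derive.
  + by apply/cvg_at_right_filter; apply: cvgN; exact: cexp.
  + by apply/cvg_at_left_filter; apply: cvgN; exact: cexp.
- by move=> t _; rewrite derive1E; exact: derive_val.
Qed.

Let gammaE_rec x : 0 < x -> E (x + 1) = (x%:E * E x)%E.
Proof.
move=> x0; have := @J_cvg (x + 1); under eq_cvg do rewrite by_parts//.
have nV : (n.+2%:R^-1 : R) @[n --> \oo] --> (0 : R).
  by have := @cvg_harmonic R; rewrite -cvg_shiftS.
have -> : (x%:E * E x = 0%:E + x%:E * E x)%E by rewrite add0e.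
move=> /cvg_unique; apply => //; apply: cvgeD.
- by rewrite fin_num_adde_defr.
- apply: cvg_EFin; first exact: nearW.
  rewrite -[0]subr0; apply: cvgB.
    apply: (@squeeze_cvgr _ _ _ _ (cst 0) (fun n => n.+2%:R^-1 `^ x)).
    - near=> n; rewrite mulr_ge0 ?powR_ge0 ?expR_ge0//= ler_piMr ?powR_ge0//.
    - exact: cvg_cst.
    - move/cvg_at_rightP : (powR_cvg0 x0); apply; by split=> [n|]; [rewrite invr_gt0|exact: nV].
  apply: (@squeeze_cvgr _ _ _ _ (cst 0) (fun n => (x + 1) `^ (x + 1) / n.+2%:R)).
  - near=> n; rewrite mulr_ge0 ?powR_ge0 ?expR_ge0//=.
    exact: powR_expRN_le.
  - exact: cvg_cst.
  - by rewrite -[X in _ --> X](mulr0 ((x + 1) `^ (x + 1))); exact: cvgMl_tmp.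
- by apply: cvgeZl => //; exact: J_cvg.
Unshelve. all: by end_near. Qed.

Let E1 : E 1 = 1%E.
Proof.
have cexp (t : R) : {for t, continuous (fun t : R => expR (- t))}.
  by apply: continuous_comp; [exact: opp_continuous|exact: continuous_expR].
have dexp (t : R) : is_derive t 1 (fun t : R => - expR (- t)) (expR (- t)).
  have := is_deriveN (is_derive1_comp (is_derive_expR (- t)) (is_deriveNid t 1)).
  by rewrite mulrN1 opprK.
rewrite /E integral_itv_obnd_cbnd; last exact: measurable_h.
transitivity (\int[mu]_(t in `[0%R, +oo[) (expR (- t : R))%:E)%E.
  by apply: eq_integral => t _; rewrite /h subrr powRr0 mul1r.
rewrite (@ge0_continuous_FTC2y _ (fun t : R => expR (- t)) (fun t : R => - expR (- t)) 0 0).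
- by rewrite oppr0 expR0 -EFinB sub0r opprK.
- by move=> t _; exact: expR_ge0.
- by apply: continuous_subspaceT => t; exact: cexp.
- by rewrite -oppr0; apply: cvgN; exact: cvgr_expR.
- by move=> t _; exact: ex_derive.
- by apply/cvg_at_right_filter; apply: cvgN; exact: cexp.
- by move=> t _; rewrite derive1E; exact: derive_val.
Qed.

Let E_gt0 x : 0 < x -> (0 < E x)%E.
Proof.
(* On [1, 2], [x > 0] gives t^(x - 1) >= 1/t >= 1/2. *)
move=> x0; apply: (@lt_le_trans _ _ (\int[mu]_(t in `[1%R, 2%R]) (cst (2^-1 * expR (- 2))%:E t))%E).
  rewrite integral_cst//= lebesgue_measure_itv/= lte_fin ltr1n -EFinB -EFinM lte_fin.
  by rewrite !mulr_gt0 ?expR_gt0 ?invr_gt0// subr_gt0 ltr1n.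
apply: (@le_trans _ _ (\int[mu]_(t in `[1%R, 2%R]) (h x t)%:E)%E).
  apply: ge0_le_integral => //=.
  - exact: measurable_h.
  - move=> t; rewrite in_itv/= => /andP[t1 t2]; rewrite lee_fin ler_pM ?expR_ge0 ?invr_ge0//.
      apply: (@le_trans _ _ (t `^ (-1))).
        by rewrite powR_inv1 ?(le_trans _ t1)// lef_pV2 ?posrE// (lt_le_trans _ t1).
      by rewrite ler_powR//; lra.
    by rewrite ler_expR lerN2.
apply: ge0_subset_integral => //.
- exact: measurable_h.
- by move=> t _; rewrite lee_fin h_ge0.
- by move=> t; rewrite /= !in_itv/= andbT => /andP[t1 _]; rewrite (lt_le_trans _ t1).
Qed.

Let E_nat_fin n : (E n.+1%:R < +oo)%E.
Proof.
elim: n => [|n IH]; first by rewrite E1 ltry.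
by rewrite -natr1 gammaE_rec// lte_mul_pinfty// lee_fin.
Qed.

(** For [y >= 1], t^(y - 1) is at most 1 when [t <= 1] and at most an integer power of [t]
    otherwise, so two integrals at integers dominate. For [x < 1] finiteness comes back from
    [x + 1], since an infinite [E x] would make [x * E x] infinite. *)
Let E_fin x : 0 < x -> (E x < +oo)%E.
Proof.
have ge1 y : 1 <= y -> (E y < +oo)%E.
  move=> y1; pose n := Num.truncn y.
  apply: (@le_lt_trans _ _ (E 1 + E n.+1%:R)%E); last first.
    by rewrite lte_add_pinfty ?E1 ?ltry ?E_nat_fin.
  rewrite -ge0_integralD//=; last 4 first.
  - by move=> t _; rewrite lee_fin h_ge0.
  - exact: measurable_h.
  - by move=> t _; rewrite lee_fin h_ge0.
  - exact: measurable_h.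
  apply: ge0_le_integral => //=.
  - by move=> t _; rewrite lee_fin h_ge0.
  - exact: measurable_h.
  - by apply: emeasurable_funD; exact: measurable_h.
  move=> t; rewrite in_itv/= andbT => t0; rewrite -EFinD lee_fin -mulrDl.
  apply: ler_wpM2r; first exact: expR_ge0.
  have [t1|t1] := leP t 1.
    apply: ler_wpDr; first exact: powR_ge0.
    by apply: ger_powR; [rewrite t0|rewrite lerD2r].
  apply: ler_wpDl; first exact: powR_ge0.
  by rewrite ler_powR ?(ltW t1)// lerD2r (ltW (truncnS_gt y)).
move=> x0; have [/ge1//|_] := leP 1 x.
have : (E (x + 1) < +oo)%E by apply: ge1; rewrite lerDr ltW.
by rewrite gammaE_rec// !ltey; apply: contra => /eqP->; rewrite gt0_muley.
Qed.

Let gammaE x : euler_gamma x = fine (E x). Proof. by []. Qed.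

Lemma euler_gamma_gt0 x : 0 < x -> 0 < euler_gamma x.
Proof. by move=> x0; rewrite gammaE fine_gt0// E_gt0//= E_fin. Qed.

Lemma euler_gammaD1 x : 0 < x -> euler_gamma (x + 1) = x * euler_gamma x.
Proof.
move=> x0; rewrite !gammaE gammaE_rec// fineM//.
by rewrite ge0_fin_numE ?E_fin// ltW ?E_gt0.
Qed.

Lemma Gamma_gt0E x : 0 < x -> Gamma x = euler_gamma x.
Proof. by move=> x0; rewrite /Gamma x0 addr0 big_ord0 divr1. Qed.

Definition rising (q : R) n := \prod_(i < n) (q + i%:R).

Lemma pochhammer_gt0E q n : 0 < q -> pochhammer q n = rising q n.
Proof.
move=> q0; rewrite /pochhammer !Gamma_gt0E ?ltr_wpDr//.
apply: (canLR (mulfK _)); first by rewrite gt_eqF ?euler_gamma_gt0.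
elim: n => [|n IH]; first by rewrite /rising big_ord0 addr0 mul1r.
rewrite -natr1 addrA euler_gammaD1 ?ltr_wpDr// IH /rising big_ord_recr/=.
by rewrite mulrA [_ * \prod_(_ < _) _]mulrC.
Qed.

(** At [-1/2] the extension of [Gamma] takes exactly one step, the truncation of 1/2 being 0, while
    [-1/2 + n.+1 = 1/2 + n] is positive again. The quotient is therefore [pochhammer 2^-1 n] with
    the factor [-1/2] put back in front. *)
Lemma pochhammer_Nhalf n : pochhammer (- 2^-1) n = rising (- 2^-1) n.
Proof.
have G0 : Gamma (- 2^-1 : R) = euler_gamma 2^-1 / (- 2^-1).
  rewrite /Gamma oppr_gt0 ltNge invr_ge0 ler0n/= opprK.
  rewrite (_ : Num.truncn (2^-1 : R) = 0%N); last first.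
    by apply/truncn0Pn; rewrite -ltNge invf_lt1// ltr1n.
  by rewrite big_ord1 addr0; congr (euler_gamma _ / _); lra.
have g0 : 0 < euler_gamma (2^-1 : R) by apply: euler_gamma_gt0; rewrite invr_gt0.
case: n => [|n].
  rewrite /pochhammer /rising big_ord0 addr0 mulfV// G0.
  by rewrite mulf_neq0// ?gt_eqF// invr_neq0// oppr_eq0 invr_neq0.
rewrite /pochhammer /rising big_ord_recl/= addr0.
have -> : - 2^-1 + n.+1%:R = 2^-1 + n%:R :> R by rewrite -[n.+1%:R]natr1; lra.
have half0 : 0 < 2^-1 :> R by rewrite invr_gt0.
have <- : pochhammer (2^-1 : R) n = \prod_(i < n) (- 2^-1 + (bump 0 i)%:R).
  rewrite pochhammer_gt0E//; apply: eq_bigr => i _.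
  by rewrite /bump/= natrD; lra.
rewrite /pochhammer (Gamma_gt0E half0) G0; field.
by rewrite gt_eqF.
Qed.

End gamma.

(** * Arc length *)

Lemma euclid_distxx (R : realType) (p : R * R) : euclid_dist p p = 0.
Proof. by rewrite /euclid_dist !subrr expr0n addr0 sqrtr0. Qed.

Lemma euclid_distC (R : realType) (p q : R * R) :
  euclid_dist p q = euclid_dist q p.
Proof.
by rewrite /euclid_dist -(opprB q.1) -(opprB q.2) !sqrrN.
Qed.

Lemma sqr_euclid_dist (R : realType) (p q : R * R) :
  euclid_dist p q ^+ 2 = (p.1 - q.1) ^+ 2 + (p.2 - q.2) ^+ 2.
Proof. by rewrite sqr_sqrtr// addr_ge0// sqr_ge0. Qed.

Lemma CauchySchwarz2 (R : realType) (x y u v : R) :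
  x * u + y * v <= Num.sqrt (x ^+ 2 + y ^+ 2) * Num.sqrt (u ^+ 2 + v ^+ 2).
Proof.
rewrite -sqrtrM ?addr_ge0 ?sqr_ge0//.
apply: le_trans (ler_norm _) _; rewrite -sqrtr_sqr; apply: ler_wsqrtr.
by rewrite -subr_ge0 [leRHS](_ : _ = (x * v - y * u) ^+ 2) ?sqr_ge0//; ring.
Qed.

Lemma euclid_dist_ge0 (R : realType) (p q : R * R) : 0 <= euclid_dist p q.
Proof. exact: sqrtr_ge0. Qed.

Lemma euclid_dist_triangle (R : realType) (p q r : R * R) :
  euclid_dist p r <= euclid_dist p q + euclid_dist q r.
Proof.
rewrite -ler_sqr ?nnegrE ?addr_ge0 ?euclid_dist_ge0// sqrrD !sqr_euclid_dist.
have := CauchySchwarz2 (p.1 - q.1) (p.2 - q.2) (q.1 - r.1) (q.2 - r.2).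
rewrite -/(euclid_dist p q) -/(euclid_dist q r); nra.
Qed.

Section arc_length.
Context {R : realType}.
Implicit Types (c g : R -> R * R) (x y z : R) (t : seq R).

Lemma polygon_length_nil c x y : polygon_length c x y [::] = 0.
Proof. by rewrite /polygon_length big_nil. Qed.

Lemma polygon_length_cons c x y z t :
  polygon_length c x z (y :: t) =
  euclid_dist (c y) (c x) + polygon_length c y z t.
Proof. by rewrite /polygon_length/= big_nat_recl. Qed.

Lemma polygon_length_cat c x y z t1 t2 : last x t1 = y ->
  polygon_length c x z (t1 ++ t2) =
  polygon_length c x y t1 + polygon_length c y z t2.
Proof.
elim: t1 x => [x <-|w t1 IH x /= lst]; first by rewrite polygon_length_nil add0r.
by rewrite !polygon_length_cons (IH w)// addrA.
Qed.

Lemma itv_partition_consE x y z t :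
  itv_partition x z (y :: t) <-> x < y /\ itv_partition y z t.
Proof.
rewrite /itv_partition/=; split; first by case=> /andP[].
by case=> -> [-> ->].
Qed.

Lemma arc_length_ge c x y t : itv_partition x y t ->
  ((polygon_length c x y t)%:E <= arc_length c x y)%E.
Proof. by move=> h; apply: ereal_sup_ubound; exists t. Qed.

Lemma arc_length_le c x y (l : \bar R) :
  (forall t, itv_partition x y t -> ((polygon_length c x y t)%:E <= l)%E) ->
  (arc_length c x y <= l)%E.
Proof. by move=> h; apply: ge_ereal_sup => _ [t /h ? <-]. Qed.

(** Inserting [y] as a vertex cannot shorten the polygon, by the triangle inequality. *)
Lemma polygon_length_split c x y z t : x <= y <= z -> itv_partition x z t ->
  exists t1 t2, [/\ itv_partition x y t1, itv_partition y z t2 &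
    polygon_length c x z t <=
    polygon_length c x y t1 + polygon_length c y z t2].
Proof.
elim: t x => [|w t IH] x /andP[xy yz].
  move=> /itv_partition_nil xz; exists [::], [::].
  have ->: y = x by apply/le_anti; rewrite xy xz yz.
  have <- : x = z by [].
  by split; rewrite /itv_partition/= ?eqxx// polygon_length_nil addr0.
move=> /itv_partition_consE[xw pt].
have [xey|xney] := eqVneq x y.
  exists [::], (w :: t); rewrite -xey; split; first by rewrite /itv_partition/=.
    exact/itv_partition_consE.
  by rewrite polygon_length_nil add0r.
have [wy|yw] := leP w y.
  have [|t1 [t2 [p1 p2 le12]]] := IH w _ pt; first by rewrite wy.
  exists (w :: t1), t2; split => //; first exact/itv_partition_consE.
  by rewrite !polygon_length_cons -addrA lerD2l.
exists [:: y], (w :: t); split.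
- by apply/itv_partition_consE; split; rewrite ?lt_neqAle ?xney// /itv_partition/=.
- exact/itv_partition_consE.
- rewrite !polygon_length_cons polygon_length_nil addr0 addrA lerD2r addrC.
  exact: euclid_dist_triangle.
Qed.

Lemma itv_partition_concat x y z t1 t2 :
  itv_partition x y t1 -> itv_partition y z t2 -> itv_partition x z (t1 ++ t2).
Proof.
by move=> [p1 /eqP l1] [p2 l2]; split; rewrite ?cat_path ?last_cat l1// p1.
Qed.

Lemma itv_partition_ex x y : x <= y -> exists t, itv_partition x y t.
Proof.
rewrite le_eqVlt => /predU1P[<-|xy]; first by exists [::]; rewrite /itv_partition/=.
by exists [:: y]; apply/itv_partition_consE; rewrite /itv_partition/=.
Qed.

Lemma arc_length_ge_dist c x y : x <= y ->
  ((euclid_dist (c y) (c x))%:E <= arc_length c x y)%E.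
Proof.
rewrite le_eqVlt => /predU1P[<-|xy].
  apply: ereal_sup_ubound; exists [::]; first by rewrite /itv_partition/=.
  by rewrite polygon_length_nil euclid_distxx.
apply: ereal_sup_ubound; exists [:: y].
  by apply/itv_partition_consE; rewrite /itv_partition/=.
by rewrite polygon_length_cons polygon_length_nil addr0.
Qed.

Lemma arc_length_ge0 c x y : x <= y -> (0 <= arc_length c x y)%E.
Proof.
move=> /(arc_length_ge_dist c); apply: le_trans.
by rewrite lee_fin euclid_dist_ge0.
Qed.

Lemma arc_length_cat c x y z : x <= y <= z ->
  arc_length c x z = (arc_length c x y + arc_length c y z)%E.
Proof.
move=> xyz; have /andP[xy yz] := xyz; apply/le_anti/andP; split.
  apply: arc_length_le => t /(polygon_length_split c xyz).
  move=> [t1 [t2 [/(arc_length_ge c) p1 /(arc_length_ge c) p2 h]]].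
  by apply: le_trans (leeD p1 p2); rewrite -EFinD lee_fin.
(* An infinite total is trivial. Otherwise finiteness allows the two suprema to be taken one after
   the other, by moving the remaining term across the inequality. *)
have [->|xzoo] := eqVneq (arc_length c x z) +oo%E; first exact: leey.
have xz0 := arc_length_ge0 c (le_trans xy yz).
have xzfin : arc_length c x z \is a fin_num by rewrite ge0_fin_numE// ltey.
have h t1 : itv_partition x y t1 ->
    ((polygon_length c x y t1)%:E + arc_length c y z <= arc_length c x z)%E.
  move=> p1; rewrite -leeBrDl//; apply: arc_length_le => t2 p2.
  rewrite leeBrDl// -EFinD -polygon_length_cat; last by case: p1 => _ /eqP.
  exact/arc_length_ge/itv_partition_concat/p2.
have yzfin : arc_length c y z \is a fin_num.
  have [t1 /h] := itv_partition_ex xy.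
  rewrite -leeBrDl// => /le_lt_trans; rewrite ge0_fin_numE ?arc_length_ge0//.
  by apply; rewrite -(fineK xzfin) -EFinB ltry.
rewrite -leeBrDr//; apply: arc_length_le => t1 /h.
by rewrite leeBrDr.
Qed.

(** An inequality only: [f] carries partitions to partitions with the same polygon length.
    Equalities follow later by applying it to the inverse map as well. *)
Lemma arc_length_iso c g (f : R -> R) x y :
  (forall p q, x <= p -> p < q -> q <= y -> f p < f q) ->
  (forall p q, x <= p -> p <= q -> q <= y ->
     euclid_dist (c q) (c p) = euclid_dist (g (f q)) (g (f p))) ->
  (arc_length c x y <= arc_length g (f x) (f y))%E.
Proof.
move=> fmono fdist; apply: arc_length_le => t pt.
suff [t' pt' ->] : exists2 t', itv_partition (f x) (f y) t' &
  polygon_length c x y t = polygon_length g (f x) (f y) t' by exact: arc_length_ge.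
elim: t x fmono fdist pt => [|w t IH] x fmono fdist.
  move=> /itv_partition_nil ->; exists [::]; first by rewrite /itv_partition/=.
  by rewrite !polygon_length_nil.
move=> /itv_partition_consE[xw pt].
have wy : w <= y := itv_partition_le pt.
have [||//|t' pt' h] := IH w.
- by move=> p q wp; apply: fmono; exact: le_trans (ltW xw) wp.
- by move=> p q wp; apply: fdist; exact: le_trans (ltW xw) wp.
- exists (f w :: t'); first by apply/itv_partition_consE; split => //; exact: fmono.
  by rewrite !polygon_length_cons h fdist// ltW.
Qed.

Lemma arc_length_antiiso c g (f : R -> R) x y :
  (forall p q, x <= p -> p < q -> q <= y -> f q < f p) ->
  (forall p q, x <= p -> p <= q -> q <= y ->
     euclid_dist (c q) (c p) = euclid_dist (g (f q)) (g (f p))) ->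
  (arc_length c x y <= arc_length g (f y) (f x))%E.
Proof.
move=> fmono fdist; apply: arc_length_le => t pt.
suff [t' pt' ->] : exists2 t', itv_partition (f y) (f x) t' &
  polygon_length c x y t = polygon_length g (f y) (f x) t' by exact: arc_length_ge.
elim: t x fmono fdist pt => [|w t IH] x fmono fdist.
  move=> /itv_partition_nil ->; exists [::]; first by rewrite /itv_partition/=.
  by rewrite !polygon_length_nil.
move=> /itv_partition_consE[xw pt].
have wy : w <= y := itv_partition_le pt.
have [||//|t' pt' h] := IH w.
- by move=> p q wp; apply: fmono; exact: le_trans (ltW xw) wp.
- by move=> p q wp; apply: fdist; exact: le_trans (ltW xw) wp.
- exists (t' ++ [:: f x]).
    apply: itv_partition_concat pt' _; apply/itv_partition_consE.
    by split; [exact: fmono|rewrite /itv_partition/=].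
  rewrite (polygon_length_cat _ (y := f w)); last by case: pt' => _ /eqP.
  rewrite !polygon_length_cons polygon_length_nil addr0 -h addrC.
  by rewrite (euclid_distC (g (f x))) -fdist// ltW.
Qed.

End arc_length.

(** * Primitives and comparison of curves *)

Section primitive.
Context {R : realType}.
Implicit Types (F G f g : R -> R) (x y p q t : R).

(** Differentiability is asked only inside because integrands such as t^(m - 1) may blow up at 0,
    where their primitives are still continuous. *)
Definition primitive_on F f x y :=
  {within `[x, y], continuous F} /\
  forall t, x < t < y -> is_derive t 1 F (f t).

Lemma primitive_onD F G f g x y :
  primitive_on F f x y -> primitive_on G g x y ->
  primitive_on (fun t => F t + G t) (fun t => f t + g t) x y.
Proof.
move=> [cF dF] [cG dG]; split; first by move=> t; apply: continuousD; [exact: cF|exact: cG].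
by move=> t xty; apply: is_deriveD; [exact: dF|exact: dG].
Qed.

Lemma primitive_onZ F f k x y :
  primitive_on F f x y ->
  primitive_on (fun t => k * F t) (fun t => k * f t) x y.
Proof.
move=> [cF dF]; split.
  by move=> t; apply: continuousM; [exact: cvg_cst|exact: cF].
by move=> t xty; apply: is_deriveZ; exact: dF.
Qed.

Lemma primitive_onB F G f g x y :
  primitive_on F f x y -> primitive_on G g x y ->
  primitive_on (fun t => F t - G t) (fun t => f t - g t) x y.
Proof.
move=> [cF dF] [cG dG]; split; first by move=> t; apply: continuousB; [exact: cF|exact: cG].
by move=> t xty; apply: is_deriveB; [exact: dF|exact: dG].
Qed.

Lemma primitive_on_sum n (F f : nat -> R -> R) x y :
  (forall i, (i < n)%N -> primitive_on (F i) (f i) x y) ->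
  primitive_on (fun t => \sum_(i < n) F i t) (fun t => \sum_(i < n) f i t) x y.
Proof.
elim: n => [_|n IH h].
  split=> [|t _].
    rewrite (_ : (fun t => _) = cst 0); last by apply/funext => t; rewrite big_ord0.
    by move=> t; exact: cvg_cst.
  rewrite big_ord0 (_ : (fun t => _) = cst 0); first exact: is_derive_cst.
  by apply/funext => u; rewrite big_ord0.
have {}IH := IH (fun i ni => h i (ltnW ni)).
have := primitive_onD IH (h n (ltnSn n)).
congr (primitive_on _ _ x y); apply/funext => t; by rewrite big_ord_recr.
Qed.

Lemma primitive_on_id x y : primitive_on id (fun=> 1) x y.
Proof. split => [|t _]; last exact: is_derive_id.
by apply: continuous_subspaceT => t; exact: cvg_id. Qed.

Lemma primitive_on_subitv F f x y p q : x <= p -> q <= y ->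
  primitive_on F f x y -> primitive_on F f p q.
Proof.
move=> xp qy [cF dF]; split.
  by apply: continuous_subspaceW cF; apply/subset_itv; rewrite bnd_simp.
move=> t /andP[pt tq]; apply: dF.
by rewrite (le_lt_trans xp pt) (lt_le_trans tq qy).
Qed.

Lemma primitive_on_homo F f x y p q :
  primitive_on F f x y -> (forall t, x < t < y -> 0 <= f t) ->
  x <= p -> p <= q -> q <= y -> F p <= F q.
Proof.
move=> prF f0 xp; rewrite le_eqVlt => /predU1P[->//|pq] qy.
have [cF dF] := primitive_on_subitv xp qy prF.
have dF' t : t \in `]p, q[ -> is_derive t 1 F (f t) by rewrite in_itv/=; exact: dF.
have [c + h] := MVT pq dF' cF.
rewrite in_itv/= => /andP[pc cq].
rewrite -subr_ge0 h mulr_ge0 ?subr_ge0 ?(ltW pq)// f0//.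
by rewrite (le_lt_trans xp pc) (lt_le_trans cq qy).
Qed.

(** A positive derivative at the single point [t] compares nearby values with [F t], not with each
    other; this is the local hypothesis of [local_homo_homo]. *)
Lemma derive_gt0_local F t l : is_derive t 1 F l -> 0 < l ->
  exists2 d, 0 < d & forall u, `|u - t| < d ->
    (t <= u -> F t <= F u) /\ (u <= t -> F u <= F t).
Proof.
move=> dF l0; have [/cvg_ex[/= l' Fl'] dFl] := dF.
have ll' : l' = l by rewrite -dFl; apply/esym/cvg_lim.
have /cvgrPdist_lt/(_ _ l0) := Fl'.
rewrite ll' => -[d /= d0 hd]; exists d => // u utd.
have [->|ut] := eqVneq u t; first by rewrite lexx.
have := hd (u - t); rewrite /ball/= sub0r normrN => /(_ utd).
rewrite subr_eq0 => /(_ ut); rewrite [_ *: 1]mulr1 subrK.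
rewrite /GRing.scale/= => hl.
have {}hl : 0 < (u - t)^-1 * (F u - F t).
  by have := ler_norm (l - (u - t)^-1 * (F u - F t)); lra.
split=> tu.
  have tu' : 0 < u - t by rewrite subr_gt0 lt_neqAle eq_sym ut.
  by move: hl; rewrite pmulr_rgt0 ?invr_gt0// subr_gt0 => /ltW.
have tu' : u - t < 0 by rewrite subr_lt0 lt_neqAle ut.
by move: hl; rewrite nmulr_rgt0 ?invr_lt0// subr_lt0 => /ltW.
Qed.

(** The supremum of the points [t] with [F p <= F t] satisfies this inequality itself, by the
    comparison on its left, and the comparison on its right forbids it to lie below [q]. The local
    hypothesis suits the arc length function, whose regularity is not known beforehand. *)
Lemma local_homo_homo F p q : p <= q ->
  (forall t, p <= t <= q -> exists2 d, 0 < d & forall u, `|u - t| < d -> p <= u <= q ->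
    (t <= u -> F t <= F u) /\ (u <= t -> F u <= F t)) ->
  F p <= F q.
Proof.
move=> pq hF; pose S := [set t | p <= t <= q /\ F p <= F t].
have Sp : S p by split=> //; rewrite lexx.
have Sq : ubound S q by move=> t [/andP[]].
have hasS : has_sup S by split; [exists p|exists q].
set s := sup S.
have ps : p <= s by apply: ub_le_sup => //; exists q.
have sq : s <= q by apply: ge_sup => //; exists p.
have [|d d0 hd] := hF s; first by rewrite ps.
have Fps : F p <= F s.
  have [t [/andP[pt tq] Fpt] st] := sup_adherent d0 hasS.
  have ts : t <= s by apply: ub_le_sup; [exists q|split; rewrite ?pt].
  have [||_ /(_ ts)] := hd t; last exact: le_trans.
    by rewrite distrC ger0_norm ?subr_ge0// ltrBlDr -ltrBlDl.
  by rewrite pt.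
move: sq; rewrite le_eqVlt => /predU1P[<-//|sq].
pose u := Num.min q (s + d / 2).
have su : s < u by rewrite lt_min sq/= ltrDl divr_gt0.
have uq : u <= q by rewrite ge_min lexx.
have ud : u <= s + d / 2 by rewrite ge_min lexx orbT.
have pu : p <= u by exact: le_trans ps (ltW su).
have [||/(_ (ltW su)) Fsu _] := hd u.
- by rewrite ger0_norm ?subr_ge0 1?ltW//; lra.
- by rewrite pu.
have : u <= s.
  by apply: ub_le_sup; [exists q|split; rewrite ?pu//; exact: le_trans Fsu].
by rewrite leNgt su.
Qed.

End primitive.

(** * Arc length against primitives of bounds on the speed *)

Section curve_comparison.
Context {R : realType}.
Variables (c : R -> R * R) (c1 c2 : R -> R) (x y : R).
Hypotheses (prc1 : primitive_on (fun t => (c t).1) c1 x y)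
  (prc2 : primitive_on (fun t => (c t).2) c2 x y).

Let speed t := Num.sqrt (c1 t ^+ 2 + c2 t ^+ 2).

(** A mean value inequality for plane curves: the curve is projected onto the fixed displacement
    [(d1, d2)]. By Cauchy-Schwarz, [d * P - d1 * c.1 - d2 * c.2] is nondecreasing, whence
    [d ^+ 2 <= d * (P q - P p)]. *)
Lemma euclid_dist_le_primitive (P p' : R -> R) p q :
  primitive_on P p' x y -> (forall t, x < t < y -> speed t <= p' t) ->
  x <= p -> p <= q -> q <= y -> euclid_dist (c q) (c p) <= P q - P p.
Proof.
move=> prP cP xp pq qy.
pose d := euclid_dist (c q) (c p).
pose d1 := (c q).1 - (c p).1; pose d2 := (c q).2 - (c p).2.
have hP : P p <= P q.
  apply: (primitive_on_homo prP) => // t /cP; apply: le_trans; exact: sqrtr_ge0.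
have d0 : 0 <= d := euclid_dist_ge0 _ _.
have := primitive_onB (primitive_onZ d prP)
  (primitive_onD (primitive_onZ d1 prc1) (primitive_onZ d2 prc2)).
move=> /primitive_on_homo/(_ _ xp pq qy).
have /[swap]/[apply] : (forall t, x < t < y -> 0 <= d * p' t - (d1 * c1 t + d2 * c2 t)).
  move=> t /cP; rewrite subr_ge0 => /(ler_wpM2l d0); apply: le_trans.
  exact: CauchySchwarz2.
have dE : d ^+ 2 = d1 ^+ 2 + d2 ^+ 2 by rewrite sqr_euclid_dist.
move=> h.
have {}h : d * d <= d * (P q - P p).
  by rewrite -expr2 dE /d1 /d2 in h *; lra.
move: d0; rewrite le_eqVlt => /predU1P[d0|d0]; last by rewrite ler_pM2l in h.
by rewrite -/d -d0 subr_ge0.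
Qed.

Lemma arc_length_le_primitive (P p' : R -> R) :
  primitive_on P p' x y -> (forall t, x < t < y -> speed t <= p' t) ->
  (arc_length c x y <= (P y - P x)%:E)%E.
Proof.
move=> prP cP; apply: arc_length_le => t pt; rewrite lee_fin.
suff : forall p, x <= p -> itv_partition p y t -> polygon_length c p y t <= P y - P p.
  exact.
elim: t {pt} => [|w t IH] p xp.
  by move=> /itv_partition_nil->; rewrite polygon_length_nil subrr.
move=> /itv_partition_consE[pw pt]; rewrite polygon_length_cons.
have xw := le_trans xp (ltW pw).
have := IH _ xw pt.
have := euclid_dist_le_primitive prP cP xp (ltW pw) (itv_partition_le pt).
lra.
Qed.

Lemma primitive_le_arc_length (P p' : R -> R) : x < y ->
  primitive_on P p' x y -> (forall t, x < t < y -> p' t <= speed t) ->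
  ((P y - P x)%:E <= arc_length c x y)%E.
Proof.
move=> xy prP cP.
have [->|xyoo] := eqVneq (arc_length c x y) +oo%E; first exact: leey.
have arcfin p q : x <= p -> p <= q -> q <= y -> arc_length c p q \is a fin_num.
  move=> xp pq qy; rewrite ge0_fin_numE ?arc_length_ge0//.
  have py := le_trans pq qy.
  apply: (@le_lt_trans _ _ (arc_length c x y)); last by rewrite ltey.
  rewrite (@arc_length_cat _ c x p y) ?xp//.
  rewrite (@arc_length_cat _ c p q y) ?pq//.
  by apply: lee_paddl; rewrite ?leeDl// arc_length_ge0.
pose V t := fine (arc_length c x t).
have VB p q : x <= p -> p <= q -> q <= y -> euclid_dist (c q) (c p) <= V q - V p.
  move=> xp pq qy; rewrite /V (@arc_length_cat _ c x p q) ?xp//.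
  have py := le_trans pq qy.
  rewrite fineD ?arcfin// addrAC subrr add0r -lee_fin fineK ?arcfin//.
  exact: arc_length_ge_dist.
(* [V t - P t + e t] is locally nondecreasing: the increments of [V] dominate
   the displacement of [c] along the direction of its velocity at [t]. *)
have loc e p q : 0 < e -> x < p -> p <= q -> q < y -> P q - P p - e * (q - p) <= V q - V p.
  move=> e0 xp pq qy.
  suff : (V p + e * p) - P p <= V q + e * q - P q by lra.
  apply: (@local_homo_homo _ (fun t => V t + e * t - P t)) => // t /andP[pt tq].
  (* The unit vector along the velocity; where the velocity vanishes, any unit vector will do. *)
  have [n1 [n2 [nn n12]]] : exists n1 n2, n1 ^+ 2 + n2 ^+ 2 = 1 /\
      n1 * c1 t + n2 * c2 t = speed t.
    have [s0|s0] := eqVneq (speed t) 0.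
      have /eqP : c1 t ^+ 2 + c2 t ^+ 2 = 0.
        by rewrite -[LHS]sqr_sqrtr ?addr_ge0 ?sqr_ge0// -/(speed t) s0 expr0n.
      rewrite paddr_eq0 ?sqr_ge0// !sqrf_eq0 => /andP[/eqP-> /eqP->].
      by exists 1, 0; rewrite s0 expr1n expr0n !mulr0 !addr0.
    have sE : speed t ^+ 2 = c1 t ^+ 2 + c2 t ^+ 2.
      by rewrite sqr_sqrtr ?addr_ge0 ?sqr_ge0.
    exists (c1 t / speed t), (c2 t / speed t); split.
      by rewrite !expr_div_n -mulrDl -sE mulfV// sqrf_eq0.
    by rewrite mulrAC -[c2 t / _ * _]mulrAC -mulrDl -!expr2 -sE expr2 mulfK.
  have xty : x < t < y by rewrite (lt_le_trans xp pt) (le_lt_trans tq qy).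
  have := primitive_onB (primitive_onD
     (primitive_onD (primitive_onZ n1 prc1) (primitive_onZ n2 prc2))
     (primitive_onZ e (primitive_on_id x y))) prP.
  move=> [_ /(_ t xty) /derive_gt0_local].
  rewrite n12 mulr1.
  have pe : 0 < speed t + e - p' t by have := cP _ xty; lra.
  move=> /(_ pe)[d d0 hd].
  exists d => // u /hd[h1 h2] /andP[pu uq].
  have nle p1 q1 : x <= p1 -> p1 <= q1 -> q1 <= y ->
      n1 * ((c q1).1 - (c p1).1) + n2 * ((c q1).2 - (c p1).2) <= V q1 - V p1.
    move=> ? ? ?; apply: le_trans (VB _ _ _ _ _) => //.
    apply: le_trans (CauchySchwarz2 _ _ _ _) _.
    by rewrite nn sqrtr1 mul1r.
  have xt : x <= t by case/andP: xty => /ltW.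
  have ty : t <= y by case/andP: xty => _ /ltW.
  have xu := le_trans (ltW xp) pu; have uy := le_trans uq (ltW qy).
  split=> tu.
    by have := h1 tu; have := nle _ _ xt tu uy; lra.
  by have := h2 tu; have := nle _ _ xu tu ty; lra.
(* Dividing [e] by [q - p + 1] keeps the total loss over [[p, q]] below [e], also when [p = q]. *)
have loc0 p q : x < p -> p <= q -> q < y -> P q - P p <= V y - V x.
  move=> xp pq qy; apply/ler_addgt0Pr => e e0.
  have py := le_trans pq (ltW qy).
  have := VB _ _ (lexx x) (ltW xp) py.
  have := VB _ _ (le_trans (ltW xp) pq) (ltW qy) (lexx y).
  have := euclid_dist_ge0 (c p) (c x); have := euclid_dist_ge0 (c y) (c q).
  have qp1 : 0 < q - p + 1 by lra.
  have := loc (e / (q - p + 1)) _ _ (divr_gt0 e0 qp1) xp pq qy.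
  have : e / (q - p + 1) * (q - p) <= e.
    rewrite mulrAC ler_pdivrMr//; nra.
  lra.
rewrite -[leRHS]fineK ?arcfin ?(ltW xy)// lee_fin.
have {}loc0 p q : x < p -> p <= q -> q < y -> P q - P p <= fine (arc_length c x y).
  move=> xp pq qy; apply: le_trans (loc0 _ _ xp pq qy) _.
  by rewrite gerBl fine_ge0// arc_length_ge0.
(* The derivatives are compared only inside, so the endpoints are reached by continuity of [P]:
   first [p] tends to [x], then [q] to [y]. *)
have [cP' _] := prP.
have [_ Px Py] := (continuous_within_itvP P xy).1 cP'.
set L := fine _ in loc0 *.
have PxL q : x < q -> q < y -> P q - L <= P x.
  move=> xq qy; apply: (cvgr_to_ge Px); near=> p.
  have /loc0 : x < p by near: p; exact: nbhs_right_gt.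
  have pq : p <= q by apply/ltW; near: p; exact: nbhs_right_lt.
  by move=> /(_ _ pq qy); lra.
suff : P y <= P x + L by lra.
apply: (cvgr_to_le Py); near=> q.
have xq : x < q by near: q; exact: nbhs_left_gt.
have qy : q < y by near: q; exact: nbhs_left_lt.
by have := PxL _ xq qy; lra.
Unshelve. all: by end_near. Qed.

End curve_comparison.

(** * Binomial series *)

Section powers.
Context {R : realType}.
Implicit Types (a b e m r t v w z : R) (k n : nat).

Lemma primitive_on_ext (F f g : R -> R) x y :
  (forall t, x < t < y -> f t = g t) -> primitive_on F f x y -> primitive_on F g x y.
Proof. by move=> fg [cF dF]; split=> // t xty; rewrite -fg//; exact: dF. Qed.

Lemma continuous_within01 (F : R -> R) :
  (forall t, 0 < t -> derivable F t 1) -> F t @[t --> 0^'+] --> F 0 ->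
  {within `[0, 1], continuous F}.
Proof.
move=> dF F0.
have cF t : 0 < t -> {for t, continuous F}.
  by move=> /dF ?; exact/differentiable_continuous/derivable1_diffP.
apply/continuous_within_itvP => //; split=> //.
- by move=> t; rewrite in_itv/= => /andP[t0 _]; exact: cF.
- exact/cvg_at_left_filter/cF.
Qed.

Lemma is_derive_powR_comp (g : R -> R) r t dg : is_derive t 1 g dg -> 0 < g t ->
  is_derive t 1 (fun v => g v `^ r) (r * g t `^ (r - 1) * dg).
Proof. by move=> dgt gt0; exact: (is_derive1_comp (is_derive1_powR r gt0) dgt). Qed.

Lemma is_derive_mulr (g h : R -> R) t dg dh :
  is_derive t 1 g dg -> is_derive t 1 h dh ->
  is_derive t 1 (fun v => g v * h v) (g t * dh + h t * dg).
Proof. exact: is_deriveM. Qed.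

Lemma is_derive_1D t : is_derive t 1 (fun v : R => 1 + v) 1.
Proof.
have := @is_deriveD R R R (cst 1) id t 1 0 1 (is_derive_cst _ _ _) (is_derive_id _ _).
by rewrite add0r.
Qed.

Lemma primitive_on_powR m : 0 < m ->
  primitive_on (fun t => t `^ m) (fun t => m * t `^ (m - 1)) 0 1.
Proof.
move=> m0; split=> [|t /andP[t0 _]]; last exact: (is_derive1_powR m).
apply: continuous_within01 => [t t0|].
  by have [] := is_derive1_powR m t0.
by rewrite powR0 ?gt_eqF//; exact: powR_cvg0.
Qed.

Lemma primitive_on_exprn k x y :
  primitive_on (fun t : R => t ^+ k) (fun t => k%:R * t ^+ k.-1) x y.
Proof.
have dX (t : R) : is_derive t 1 (fun t : R => t ^+ k) (k%:R * t ^+ k.-1).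
  have := @is_deriveX R R id k t 1 1 (is_derive_id t 1).
  by rewrite [_ *: 1]mulr1 exprfctE.
split=> // ; apply: derivable_within_continuous => t _; exact: ex_derive.
Qed.

(** The coefficient of v^k in (1 - v)^(-a); the signs for (1 + v)^(-a) are kept apart. *)
Definition binom_coef a k := rising a k / k`!%:R.

Lemma risingS_l a n : rising a n.+1 = a * rising (a + 1) n.
Proof.
rewrite /rising big_ord_recl addr0; congr (_ * _); apply: eq_bigr => i _.
by rewrite /bump/= natrD addrA.
Qed.

Lemma risingS_r a n : rising a n.+1 = rising a n * (a + n%:R).
Proof. by rewrite /rising big_ord_recr. Qed.

Lemma rising_gt0 a n : 0 < a -> 0 < rising a n.
Proof. by move=> a0; apply: prodr_gt0 => i _; rewrite ltr_wpDr. Qed.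

Lemma rising1 n : rising (1 : R) n = n`!%:R.
Proof.
elim: n => [|n IH]; first by rewrite /rising big_ord0.
by rewrite risingS_r IH factS natrM mulrC nat1r.
Qed.

Lemma binom_coef_gt0 a k : 0 < a -> 0 < binom_coef a k.
Proof. by move=> a0; rewrite divr_gt0 ?rising_gt0// ltr0n fact_gt0. Qed.

Lemma binom_coefS a k : k.+1%:R * binom_coef a k.+1 = a * binom_coef (a + 1) k.
Proof.
rewrite /binom_coef risingS_l factS natrM; field.
by rewrite nat1r !pnatr_eq0 -lt0n fact_gt0.
Qed.

Definition binom_sum a n v := \sum_(k < n) (-1) ^+ k * binom_coef a k * v ^+ k.

Lemma binom_sumS0 a n : binom_sum a n.+1 0 = 1.
Proof.
rewrite /binom_sum big_ord_recl/= big1 => [|i _]; last by rewrite expr0n mulr0.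
by rewrite /binom_coef /rising big_ord0 divr1 !mulr1 addr0.
Qed.

(** Differentiation lowers the order of the remainder by one and raises the exponent by one, by
    [binom_coefS]. *)
Lemma primitive_on_binom_rem a n : 0 < a ->
  primitive_on (fun v => (1 + v) `^ (- a) - binom_sum a n.+1 v)
    (fun v => - a * ((1 + v) `^ (- (a + 1)) - binom_sum (a + 1) n v)) 0 1.
Proof.
move=> a0.
have dP t : - 1 < t -> is_derive t 1 (fun v => (1 + v) `^ (- a)) (- a * (1 + t) `^ (- (a + 1))).
  move=> t1; have t10 : 0 < 1 + t by lra.
  have := is_derive_powR_comp (- a) (is_derive_1D t) t10.
  by rewrite mulr1 opprD.
have P1 : primitive_on (fun v => (1 + v) `^ (- a)) (fun v => - a * (1 + v) `^ (- (a + 1))) 0 1.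
  split=> [|t /andP[t0 _]]; last by apply: dP; lra.
  apply: derivable_within_continuous => t; rewrite in_itv/= => /andP[t0 _].
  by have [] := dP t (lt_le_trans (ltrN10 R) t0).
have P2 := @primitive_on_sum R n.+1 (fun k v => (-1) ^+ k * binom_coef a k * v ^+ k) _ 0 1
  (fun k _ => primitive_onZ ((-1) ^+ k * binom_coef a k) (primitive_on_exprn k 0 1)).
apply: primitive_on_ext (primitive_onB P1 P2) => t _.
rewrite mulrBr; congr (_ - _).
rewrite big_ord_recl/= mul0r mulr0 add0r /binom_sum mulr_sumr; apply: eq_bigr => i _.
rewrite /bump/= add1n exprS.
transitivity (- ((-1) ^+ i * t ^+ i * (i.+1%:R * binom_coef a i.+1))); first by ring.
by rewrite binom_coefS; ring.
Qed.

(** Induction on [n] for all exponents at once: the remainder vanishes at 0 and its derivative is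
    enclosed by the induction hypothesis at [a + 1]. The alternating series test would not do, since
    the coefficients increase when [a > 1]. *)
Lemma binom_rem_bound a n v : 0 < a -> 0 <= v -> v <= 1 ->
  0 <= (-1) ^+ n * ((1 + v) `^ (- a) - binom_sum a n v) <= binom_coef a n * v ^+ n.
Proof.
elim: n a v => [|n IH] a v a0 v0 v1.
  rewrite /binom_sum big_ord0 subr0 mul1r powR_ge0 /binom_coef /rising big_ord0 divr1 !mulr1/=.
  by rewrite -[leRHS](powRr0 (1 + v)) ler_powR ?lerDl// oppr_le0 ltW.
have a10 : 0 < a + 1 by lra.
have dR := @primitive_onZ R _ _ ((-1) ^+ n.+1) _ _ (primitive_on_binom_rem n a0).
have sgn : forall x : R, (-1) ^+ n.+1 * (- a * x) = a * ((-1) ^+ n * x).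
  by move=> x; rewrite exprS; ring.
have at0 : (-1) ^+ n.+1 * ((1 + 0) `^ (- a) - binom_sum a n.+1 0) = 0.
  by rewrite addr0 powR1 binom_sumS0 subrr mulr0.
have H t : 0 < t < 1 -> _ := fun t01 =>
  andP (IH (a + 1) t a10 (ltW (andP t01).1) (ltW (andP t01).2)).
apply/andP; split.
  rewrite -at0; apply: (primitive_on_homo dR) => // t /H[h1 _].
  by rewrite sgn mulr_ge0// ltW.
have dV := primitive_onB (primitive_onZ (binom_coef a n.+1) (primitive_on_exprn n.+1 0 1)) dR.
rewrite -subr_ge0.
have <- : binom_coef a n.+1 * 0 ^+ n.+1 -
    (-1) ^+ n.+1 * ((1 + 0) `^ (- a) - binom_sum a n.+1 0) = 0.
  by rewrite at0 expr0n mulr0 subrr.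
apply: (primitive_on_homo dV) => // t /H[_ h2].
rewrite sgn mulrA [binom_coef _ _ * _]mulrC binom_coefS/= -mulrA -mulrBr mulr_ge0 ?subr_ge0//.
exact: ltW.
Qed.

End powers.

(** * Moments of the square root and 2F1 *)

Section gauss_series.
Context {R : realType}.
Implicit Types (C z : R) (n : nat).

Lemma gauss_term_Nhalf1 n C z : 0 < C ->
  gauss_term (- 2^-1) 1 C z n = rising (- 2^-1) n / rising C n * z ^+ n.
Proof.
move=> C0; rewrite /gauss_term pochhammer_Nhalf !pochhammer_gt0E// rising1.
have r0 : rising C n != 0 by rewrite gt_eqF// rising_gt0.
by field; rewrite r0 pnatr_eq0 -lt0n fact_gt0.
Qed.

Lemma normr_rising_Nhalf_le n : `|rising (- 2^-1 : R) n| <= n`!%:R.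
Proof.
rewrite -rising1 /rising normr_prod; apply: ler_prod => i _.
rewrite normr_ge0/=; case: i => -[|i] ? /=.
  by rewrite addr0 normrN ger0_norm ?invr_ge0//; lra.
have := ler0n R i; have -> : i.+1%:R = i%:R + 1 :> R by rewrite natr1.
by move=> i0; rewrite ger0_norm; lra.
Qed.

(** Since [1 <= C], the rising factorial of [-1/2] is at most n! = (1)_n <= (C)_n in absolute
    value. *)
Lemma normr_gauss_term_Nhalf1 n C z : 1 <= C -> 0 <= z ->
  `|gauss_term (- 2^-1) 1 C z n| <= z ^+ n.
Proof.
move=> C1 z0; have C0 : 0 < C := lt_le_trans ltr01 C1.
rewrite gauss_term_Nhalf1// !normrM normfV (gtr0_norm (rising_gt0 n C0)).
rewrite (ger0_norm (exprn_ge0 n z0)) ler_piMl ?exprn_ge0//.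
rewrite ler_pdivrMr ?rising_gt0// mul1r.
apply: le_trans (normr_rising_Nhalf_le n) _; rewrite -rising1.
by apply: ler_prod => i _; rewrite addr_ge0//= lerD2r.
Qed.

Lemma abs_cvg_gauss_Nhalf1 C z : 1 <= C -> 0 <= z < 1 ->
  abs_cvg_gauss_series (- 2^-1) 1 C z.
Proof.
move=> C1 /andP[z0 z1].
have ncvg : cvgn [normed series (gauss_term (- 2^-1) 1 C z)].
  apply: (@series_le_cvg _ _ (fun n => z ^+ n)) => [n|n|n|].
  - exact: normr_ge0.
  - exact: exprn_ge0.
  - exact: normr_gauss_term_Nhalf1.
  - have := @is_cvg_geometric_series R 1 z; rewrite ger0_norm// => /(_ z1).
    by congr (cvgn (series _)); apply/funext => n /=; rewrite mul1r.
by split=> //; exact: normed_cvg.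
Qed.

(** The bound is independent of [C], hence uniform in [k] when [C = u k + 1]; the Abel series is
    dominated through it. *)
Lemma normr_hyp2F1_Nhalf1 C z : 1 <= C -> 0 <= z < 1 ->
  `|hyp2F1 (- 2^-1) 1 C z| <= (1 - z)^-1.
Proof.
move=> C1 z01; have /andP[z0 z1] := z01.
have [_ /cvg_norm h] := abs_cvg_gauss_Nhalf1 C1 z01.
apply: (cvgr_to_le h); near=> n.
rewrite /series/=; apply: le_trans (ler_norm_sum _ _ _) _.
apply: (@le_trans _ _ (\sum_(0 <= k < n) z ^+ k)).
  by apply: ler_sum => k _; exact: normr_gauss_term_Nhalf1.
have /(congr1 (fun g => g n)) /= geoE := @geometric_seriesE R 1 z (negbT (lt_eqF z1)).
have -> : \sum_(0 <= k < n) z ^+ k = (1 - z ^+ n) / (1 - z).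
  rewrite -[X in X / _]mul1r -geoE /series/=.
  by apply: eq_bigr => k _; rewrite mul1r.
rewrite ler_pdivrMr ?subr_gt0// mulVf ?gt_eqF ?subr_gt0//.
by rewrite gerBl exprn_ge0.
Unshelve. all: by end_near. Qed.

End gauss_series.

(** * Moments of the square root by repeated integration by parts *)

Section hypergeometric_primitive.
Context {R : realType}.
Variables (A B m w : R).
Hypotheses (A_gt0 : 0 < A) (B_gt0 : 0 < B) (m_gt0 : 0 < m) (w_gt0 : 0 < w).
Implicit Types (n N : nat) (t : R).

Let u := m / w.
Let z := B / (A + B).
Let f t := A + B * t `^ w.
(** [sigma 0] is the moment integrand. Integrating [sigma n] by parts, with its power of [t] as the
    factor to be integrated, produces a multiple of the boundary term [tau n] and a multiple of
    [sigma n.+1]; [c] and [d] accumulate these factors. *)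
Let sigma n t := t `^ (m - 1 + n%:R * w) * f t `^ (2^-1 - n%:R).
Let tau n t := t `^ (m + n%:R * w) * f t `^ (2^-1 - n%:R).
Let c n := rising (- 2^-1) n / rising u n * B ^+ n.
Let d n := rising (- 2^-1) n / (w * rising u n.+1) * B ^+ n.

Let u_gt0 : 0 < u. Proof. exact: divr_gt0. Qed.

Let powR_le1 t : 0 <= t -> t <= 1 -> t `^ w <= 1.
Proof.
move=> t0 t1; have := @ge0_ler_powR R w (ltW w_gt0) t 1.
by rewrite powR1 !nnegrE; apply.
Qed.

Let f_gt0 t : 0 < f t.
Proof. by rewrite ltr_wpDr// mulr_ge0 ?powR_ge0// ltW. Qed.

Let is_derive_tau n t : 0 < t -> is_derive t 1 (tau n)
  ((m + n%:R * w) * sigma n t + (2^-1 - n%:R) * B * w * sigma n.+1 t).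
Proof.
move=> t0.
have df : is_derive t 1 f (B * (w * t `^ (w - 1))).
  have := @is_deriveD R R R (cst A) (fun v => B * v `^ w) t 1 _ _ (is_derive_cst _ _ _)
    (is_deriveZ B (is_derive1_powR w t0)).
  by rewrite add0r.
have := is_derive_mulr (is_derive1_powR (m + n%:R * w) t0)
  (is_derive_powR_comp (2^-1 - n%:R) df (f_gt0 t)).
congr is_derive.
rewrite /sigma.
have -> : m - 1 + n.+1%:R * w = m + n%:R * w + (w - 1) by rewrite -natr1; ring.
have -> : m + n%:R * w - 1 = m - 1 + n%:R * w by ring.
have -> : 2^-1 - n%:R - 1 = 2^-1 - n.+1%:R :> R by rewrite -[n.+1%:R]natr1; ring.
rewrite (@powRD _ _ _ (w - 1)) ?(gt_eqF t0) ?implybT//; ring.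
Qed.

Let tau_cvg0 n : tau n t @[t --> 0^'+] --> tau n 0.
Proof.
have mnw : 0 < m + n%:R * w by rewrite ltr_wpDr// mulr_ge0// ltW.
rewrite /tau powR0 ?gt_eqF// mul0r.
(* [f t] stays between [A] and [A + B], and its power is largest at one end or the other according
   to the sign of the exponent; the sum of both end values covers the two cases. *)
apply: (@squeeze_cvgr _ _ _ _ (cst 0)
  (fun t => t `^ (m + n%:R * w) * (A `^ (2^-1 - n%:R) + (A + B) `^ (2^-1 - n%:R)))).
- near=> t.
  have t0 : 0 < t by near: t; exact: nbhs_right_gt.
  have t1 : t < 1 by near: t; exact: nbhs_right_lt.
  rewrite mulr_ge0 ?powR_ge0//= ler_wpM2l ?powR_ge0//.
  have Af : A <= f t by rewrite lerDl mulr_ge0 ?powR_ge0// ltW.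
  have fAB : f t <= A + B.
    by rewrite lerD2l ler_piMr ?(ltW B_gt0)// powR_le1// ltW.
  have AB0 : 0 < A + B by rewrite addr_gt0.
  have [r0|r0] := leP 0 (2^-1 - n%:R : R).
    rewrite ler_wpDl ?powR_ge0// ge0_ler_powR// nnegrE ltW//.
  rewrite ler_wpDr ?powR_ge0// -[_ - _]opprK !(powRN _ (- _)) lef_pV2 ?posrE ?powR_gt0//.
  by rewrite ge0_ler_powR ?nnegrE ?oppr_ge0 ?(ltW r0) ?(ltW A_gt0) ?(ltW (f_gt0 t)).
- exact: cvg_cst.
- rewrite -[X in _ --> X](mul0r (A `^ (2^-1 - n%:R) + (A + B) `^ (2^-1 - n%:R))).
  by apply: cvgMr_tmp; exact: powR_cvg0.
Unshelve. all: by end_near. Qed.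

Let primitive_on_tau n : primitive_on (tau n)
  (fun t => (m + n%:R * w) * sigma n t + (2^-1 - n%:R) * B * w * sigma n.+1 t) 0 1.
Proof.
split=> [|t /andP[t0 _]]; last exact: is_derive_tau.
apply: continuous_within01 => [t t0|]; last exact: tau_cvg0.
by have [] := is_derive_tau n t0.
Qed.

(* Repeated integration by parts: the derivative of [d n * tau n] is
   [c n * sigma n - c n.+1 * sigma n.+1], so that of the sum telescopes. *)
Definition approx_primitive N t := \sum_(n < N) d n * tau n t.

Definition approx_deriv N t := t `^ (m - 1) * Num.sqrt (f t) - c N * sigma N t.

Lemma primitive_on_approx N :
  primitive_on (approx_primitive N) (approx_deriv N) 0 1.
Proof.
apply: (@primitive_on_ext _ _ (fun t => sigma 0 t - c N * sigma N t)) => [t _|].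
  by rewrite /approx_deriv {1}/sigma mul0r addr0 subr0 powR12_sqrt ?(ltW (f_gt0 t)).
have := @primitive_on_sum R N (fun n t => d n * tau n t) _ 0 1
  (fun n _ => primitive_onZ (d n) (primitive_on_tau n)).
apply: primitive_on_ext => t _; elim: N => [|N IH].
  by rewrite big_ord0 /c /rising !big_ord0 divr1 mulr1 mul1r subrr.
rewrite big_ord_recr/= {}IH /c /d !risingS_r.
have rn0 : rising u N != 0 by rewrite gt_eqF// rising_gt0.
have uN : u + N%:R != 0 by rewrite gt_eqF// ltr_wpDr.
have w0 : w != 0 by rewrite gt_eqF.
have -> : m + N%:R * w = w * (u + N%:R) by rewrite /u; field.
by rewrite exprS; field; rewrite rn0 uN.
Qed.

Lemma approx_primitive0 N : approx_primitive N 0 = 0.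
Proof.
rewrite /approx_primitive big1// => n _.
by rewrite /tau powR0 ?mul0r ?mulr0// gt_eqF// ltr_wpDr// mulr_ge0// ltW.
Qed.

(** At [t = 1] the radicand is [A + B], so its power [1/2 - n] turns [B ^+ n] into [z ^+ n] and
    leaves one square root. Writing [rising u n.+1] as [u * rising (u + 1) n] yields the third
    parameter [u + 1]. *)
Lemma approx_primitive1 N : approx_primitive N 1 =
  Num.sqrt (A + B) / m * series (gauss_term (- 2^-1) 1 (u + 1) z) N.
Proof.
have AB0 : 0 < A + B by rewrite addr_gt0.
rewrite /approx_primitive /series/= mulr_sumr big_mkord; apply: eq_bigr => n _.
rewrite gauss_term_Nhalf1 ?ltr_wpDl ?(ltW u_gt0)// /tau /f !powR1 mul1r mulr1 /d risingS_l.
rewrite powRB ?(gt_eqF AB0) ?implybT// powR12_sqrt ?(ltW AB0)// powR_mulrn ?(ltW AB0)//.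
have r0 : rising (u + 1) n != 0 by rewrite gt_eqF// rising_gt0// addr_gt0.
rewrite /z expr_div_n /u in r0 *; field.
by rewrite r0 !gt_eqF ?exprn_gt0.
Qed.

Lemma normr_rising_Nhalf n : `|rising (- 2^-1 : R) n.+1| <= 2^-1 * n`!%:R.
Proof.
rewrite risingS_l normrM normrN (ger0_norm (_ : 0 <= 2^-1)) ?invr_ge0//.
rewrite ler_wpM2l ?invr_ge0//.
rewrite -rising1 ger0_norm; last by apply: ltW; apply: rising_gt0; lra.
by apply: ler_prod => i _; apply/andP; split; have := ler0n R i; lra.
Qed.

(** The remainder is geometric uniformly in [t]: B t^w / f(t) is at most its value [z] at [t = 1],
    and once the first factors 1/2 and [u] are taken out, the remaining products satisfy (1/2)_N <=
    N! <= (u + 1)_N. *)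
Lemma approx_deriv_err N t : 0 < t <= 1 ->
  `|t `^ (m - 1) * Num.sqrt (A + B * t `^ w) - approx_deriv N.+1 t| <=
  Num.sqrt (A + B) / (2 * u) * z ^+ N.+1 * t `^ (m - 1).
Proof.
rewrite opprB addrC subrK.
move=> /andP[t0 t1].
have AB0 : 0 < A + B by rewrite addr_gt0.
have tw0 : 0 < t `^ w by rewrite powR_gt0.
have tw1 : t `^ w <= 1 by rewrite powR_le1// ltW.
have ft := f_gt0 t.
have fAB : f t <= A + B by rewrite lerD2l ler_piMr ?(ltW B_gt0).
have sigmaE : sigma N.+1 t = t `^ (m - 1) * Num.sqrt (f t) * (t `^ w / f t) ^+ N.+1.
  rewrite /sigma powRD ?(gt_eqF t0) ?implybT// (@powRB _ (f t)) ?(gt_eqF ft) ?implybT//.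
  rewrite powR12_sqrt ?(ltW ft)// powR_mulrn ?(ltW ft)// (mulrC _ w) powRrM.
  by rewrite powR_mulrn ?powR_ge0// expr_div_n; field; rewrite expf_neq0 ?gt_eqF.
have ru0 : 0 < rising u N.+1 by rewrite rising_gt0.
rewrite normrM sigmaE /c !normrM normfV (gtr0_norm ru0) !normrX.
rewrite (gtr0_norm B_gt0) (ger0_norm (powR_ge0 _ _)) (ger0_norm (sqrtr_ge0 _)).
rewrite normrM normfV (gtr0_norm tw0) (gtr0_norm ft).
have h1 : `|rising (- 2^-1) N.+1| / rising u N.+1 <= (2 * u)^-1.
  rewrite ler_pdivrMr//; apply: le_trans (normr_rising_Nhalf N) _.
  rewrite invfM -mulrA ler_wpM2l ?invr_ge0// risingS_l mulKf ?gt_eqF//.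
  rewrite -rising1; apply: ler_prod => i _; apply/andP; split; first by rewrite addr_ge0.
  by rewrite lerD2r lerDr (ltW u_gt0).
have h2 : Num.sqrt (f t) <= Num.sqrt (A + B) by rewrite ler_wsqrtr.
have h3 : (B * (t `^ w / f t)) ^+ N.+1 <= z ^+ N.+1.
  rewrite lerXn2r ?nnegrE ?mulr_ge0 ?invr_ge0 ?(ltW B_gt0) ?(ltW AB0) ?(ltW ft) ?(ltW tw0)//.
  rewrite /z ler_wpM2l ?(ltW B_gt0)// ler_pdivrMr// ler_pdivlMl//.
  by rewrite mulrDl lerD2r ler_piMr ?(ltW A_gt0).
have -> : `|rising (- 2^-1) N.+1| / rising u N.+1 * B ^+ N.+1 *
    (t `^ (m - 1) * Num.sqrt (f t) * (t `^ w / f t) ^+ N.+1) =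
    Num.sqrt (f t) * (`|rising (- 2^-1) N.+1| / rising u N.+1) *
    (B * (t `^ w / f t)) ^+ N.+1 * t `^ (m - 1).
  rewrite (exprMn _ B); set X := (_ / f t) ^+ _; set Y := B ^+ _.
  by set Z := `|_|; set V := rising u _; ring.
rewrite ler_wpM2r ?powR_ge0// ler_pM ?mulr_ge0 ?sqrtr_ge0 ?invr_ge0 ?(ltW ru0)//.
  by rewrite exprn_ge0// !mulr_ge0 ?invr_ge0 ?(ltW B_gt0) ?(ltW ft) ?(ltW tw0).
by rewrite ler_pM ?sqrtr_ge0 ?mulr_ge0 ?invr_ge0 ?(ltW ru0).
Qed.

End hypergeometric_primitive.

(** * Length of a half quarter *)

Section half_arc.
Context {R : realType}.

Lemma primitive_on_powRV (m : R) : 0 < m ->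
  primitive_on (fun t => m^-1 * t `^ m) (fun t => t `^ (m - 1)) 0 1.
Proof.
move=> m0; apply: primitive_on_ext (primitive_onZ m^-1 (primitive_on_powR m0)) => t _.
by rewrite mulrA mulVf ?mul1r// gt_eqF.
Qed.

Lemma powRN_lipschitz (al x y : R) : 0 < al -> 1 <= x -> x <= y ->
  `|y `^ (- al) - x `^ (- al)| <= al * (y - x).
Proof.
move=> al0 x1 xy; have x0 : 0 < x := lt_le_trans ltr01 x1.
have y0 : 0 < y := lt_le_trans x0 xy.
have pr : primitive_on (fun t => t `^ (- al)) (fun t => - al * t `^ (- al - 1)) x y.
  have d t : x <= t -> is_derive t 1 (fun t => t `^ (- al)) (- al * t `^ (- al - 1)).
    by move=> xt; exact: (is_derive1_powR (- al) (lt_le_trans x0 xt)).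
  split=> [|t /andP[xt _]]; last by apply: d; exact: ltW.
  apply: derivable_within_continuous => t; rewrite in_itv/= => /andP[xt _].
  by have [] := d t xt.
have h1 : y `^ (- al) <= x `^ (- al).
  rewrite !powRN lef_pV2 ?posrE ?powR_gt0//.
  by rewrite ge0_ler_powR ?nnegrE ?(ltW al0) ?(ltW x0) ?(ltW y0).
have h2 : x `^ (- al) + al * x <= y `^ (- al) + al * y.
  apply: (primitive_on_homo (primitive_onD pr (primitive_onZ al (primitive_on_id x y)))) => // t.
  move=> /andP[xt ty]; rewrite mulr1 mulNr addrC subr_ge0 ler_piMr ?(ltW al0)//.
  rewrite -[leRHS](powRr0 t) ler_powR ?(le_trans x1 (ltW xt))//; lra.
rewrite distrC ger0_norm ?subr_ge0//; lra.
Qed.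

(** The first term pays for replacing [t] by [e * t], the second for truncating the series. *)
Lemma binom_sum_err (al e t : R) n : 0 < al -> 0 < e -> e <= 1 -> 0 <= t -> t <= 1 ->
  `|(1 + t) `^ (- al) - binom_sum al n (e * t)| <=
  al * (1 - e) * t + binom_coef al n * e ^+ n * t ^+ n.
Proof.
move=> al0 e0 e1 t0 t1.
have et0 : 0 <= e * t by rewrite mulr_ge0// ltW.
have ett : e * t <= t by rewrite ler_piMl.
apply: le_trans (ler_distD ((1 + e * t) `^ (- al)) _ _) _; apply: lerD.
  apply: le_trans (powRN_lipschitz al0 _ _) _; rewrite ?lerDl ?lerD2l//; lra.
have /andP[h1 h2] := binom_rem_bound n al0 et0 (le_trans ett t1).
rewrite -mulrA -exprMn; apply: le_trans h2; rewrite -[leRHS]ger0_norm//.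
by rewrite normrM normrX normrN1 expr1n mul1r.
Qed.

Lemma cvg_sum_ord n (u : nat -> R ^nat) (l : nat -> R) :
  (forall k, (k < n)%N -> u k N @[N --> \oo] --> l k) ->
  \sum_(k < n) u k N @[N --> \oo] --> \sum_(k < n) l k.
Proof.
elim: n => [|n IH] h.
  by rewrite big_ord0; under eq_cvg do rewrite big_ord0; exact: cvg_cst.
rewrite big_ord_recr/=; under eq_cvg do rewrite big_ord_recr/=.
by apply: cvgD; [apply: IH => k kn; exact/h/ltnW|exact: h].
Qed.

(** * Length of a curve whose speed has the form common to both cases *)

Variables (A B mu w K al : R).
Hypotheses (A_gt0 : 0 < A) (B_gt0 : 0 < B) (mu_gt0 : 0 < mu) (w_gt0 : 0 < w)
  (K_gt0 : 0 < K) (al_gt0 : 0 < al).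
Variables (c : R -> R * R) (c1 c2 : R -> R).
Hypotheses (prc1 : primitive_on (fun t => (c t).1) c1 0 1)
  (prc2 : primitive_on (fun t => (c t).2) c2 0 1).
Hypothesis speedE : forall t, 0 < t < 1 -> Num.sqrt (c1 t ^+ 2 + c2 t ^+ 2) =
  K * (1 + t) `^ (- al) * (t `^ (mu - 1) * Num.sqrt (A + B * t `^ w)).

Let S := Num.sqrt (A + B).
Let z := B / (A + B).
Let F k := hyp2F1 (- 2^-1) 1 ((k%:R + mu) / w + 1) z.
Let q t := t `^ (mu - 1) * Num.sqrt (A + B * t `^ w).

(** The partial sum for the length, up to the factor [K * S]. The power of [- e] joins the sign of
    the binomial series with the Abel factor. *)
Definition arc_sum e n := \sum_(k < n) (- e) ^+ k * binom_coef al k * (F k / (k%:R + mu)).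

Section estimate.
Variables (e : R) (n : nat).
Hypotheses (e_gt0 : 0 < e) (e_le1 : e <= 1).

Let kmu_gt0 k : 0 < k%:R + mu. Proof. by rewrite ltr_wpDl. Qed.

(** There are two truncations: [n] terms of the binomial series and, for each of them, [N.+1]
    integrations by parts. *)
Let T N k t := K * (- e) ^+ k * binom_coef al k *
  approx_primitive A B (k%:R + mu) w N.+1 t.
Let T' N k t := K * (- e) ^+ k * binom_coef al k *
  approx_deriv A B (k%:R + mu) w N.+1 t.
Let P N t := \sum_(k < n) T N k t.
Let p' N t := \sum_(k < n) T' N k t.
Let r k N := K * binom_coef al k * (S / (2 * ((k%:R + mu) / w)) * z ^+ N.+1).
(** A primitive of the error bound, with one part for each source of error: the shift to [e * t],
    the truncated binomial series and the truncated integrations by parts. *)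
Let E N t := K * S * (al * (1 - e)) * ((mu + 1)^-1 * t `^ (mu + 1)) +
  K * S * (binom_coef al n * e ^+ n) * ((n%:R + mu)^-1 * t `^ (n%:R + mu)) +
  \sum_(k < n) r k N * ((k%:R + mu)^-1 * t `^ (k%:R + mu)).
Let e' N t := K * S * (al * (1 - e)) * t `^ (mu + 1 - 1) +
  K * S * (binom_coef al n * e ^+ n) * t `^ (n%:R + mu - 1) +
  \sum_(k < n) r k N * t `^ (k%:R + mu - 1).

Let primP N : primitive_on (P N) (p' N) 0 1.
Proof.
apply: (@primitive_on_sum _ n (T N) (T' N)) => k _.
exact/primitive_onZ/primitive_on_approx.
Qed.

Let primE N : primitive_on (E N) (e' N) 0 1.
Proof.
apply: primitive_onD.
  apply: primitive_onD; apply: primitive_onZ; apply: primitive_on_powRV => //.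
  by rewrite addr_gt0.
apply: (@primitive_on_sum _ n (fun k t => r k N * ((k%:R + mu)^-1 * t `^ (k%:R + mu)))
  (fun k t => r k N * t `^ (k%:R + mu - 1))) => k _.
exact/primitive_onZ/primitive_on_powRV.
Qed.

Let powRS k t : 0 < t -> t `^ (k%:R + mu - 1) = t ^+ k * t `^ (mu - 1).
Proof.
by move=> t0; rewrite -addrA (@powRD _ _ k%:R) ?(gt_eqF t0) ?implybT// powR_mulrn ?(ltW t0).
Qed.

Let speed_err N t : 0 < t < 1 ->
  `|K * (1 + t) `^ (- al) * q t - p' N t| <= e' N t.
Proof.
move=> t01; have /andP[t0 t1] := t01; have [t0' t1'] := (ltW t0, ltW t1).
have q0 : 0 <= q t by rewrite mulr_ge0 ?powR_ge0 ?sqrtr_ge0.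
have qS : q t <= S * t `^ (mu - 1).
  rewrite /q [leLHS]mulrC ler_wpM2r ?powR_ge0// ler_wsqrtr// lerD2l ler_piMr ?(ltW B_gt0)//.
  by have := @ge0_ler_powR R w (ltW w_gt0) t 1; rewrite powR1 !nnegrE; apply.
have -> : K * (1 + t) `^ (- al) * q t - p' N t =
    K * (((1 + t) `^ (- al) - binom_sum al n (e * t)) * q t) +
    \sum_(k < n) K * (- e) ^+ k * binom_coef al k *
      (t ^+ k * q t - approx_deriv A B (k%:R + mu) w N.+1 t).
  have bsE : K * (binom_sum al n (e * t) * q t) =
      \sum_(k < n) K * (- e) ^+ k * binom_coef al k * (t ^+ k * q t).
    rewrite mulr_suml mulr_sumr; apply: eq_bigr => k _.
    by rewrite [in RHS]exprNn [in LHS]exprMn; ring.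
  under eq_bigr do rewrite mulrBr.
  by rewrite sumrB -bsE /p' /T'; ring.
apply: le_trans (ler_normD _ _) _; rewrite /e'; apply: lerD.
  rewrite normrM (gtr0_norm K_gt0) normrM (ger0_norm q0).
  have h := binom_sum_err n al_gt0 e_gt0 e_le1 t0' t1'.
  apply: (@le_trans _ _ (K * ((al * (1 - e) * t +
      binom_coef al n * e ^+ n * t ^+ n) * (S * t `^ (mu - 1))))).
    by rewrite ler_wpM2l ?(ltW K_gt0)// ler_pM.
  rewrite powRS// (_ : mu + 1 - 1 = 1%:R + mu - 1); last by rewrite (addrC mu).
  by rewrite powRS// expr1 le_eqVlt; apply/orP; left; apply/eqP; ring.
apply: le_trans (ler_norm_sum _ _ _) _; apply: ler_sum => k _.
have := approx_deriv_err A_gt0 B_gt0 (kmu_gt0 k) w_gt0 N (t := t).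
rewrite t0 t1' -/S -/z powRS// -(mulrA (t ^+ k)) => /(_ isT) h.
have := binom_coef_gt0 k al_gt0; rewrite /r; move: (binom_coef al k) => b b0.
rewrite normrM (normrM (K * _)) (normrM K) normrX normrN.
rewrite (gtr0_norm K_gt0) (gtr0_norm e_gt0) (gtr0_norm b0) (mulrAC K) -!(mulrA (K * b)).
rewrite ler_wpM2l ?mulr_ge0 ?(ltW K_gt0) ?(ltW b0)//; apply: le_trans h.
by rewrite ler_piMl// exprn_ile1// ltW.
Qed.

Let P0 N : P N 0 = 0.
Proof. by rewrite /P big1// => k _; rewrite /T approx_primitive0 ?mulr0. Qed.

Let E0 N : E N 0 = 0.
Proof.
have h m (m0 : 0 < m) : m^-1 * 0 `^ m = 0 :> R by rewrite powR0 ?mulr0// gt_eqF.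
rewrite /E (h _ (addr_gt0 mu_gt0 ltr01)) (h _ (kmu_gt0 n)) !mulr0 !add0r.
rewrite big1// => k _.
by rewrite h ?mulr0.
Qed.

Let arc_le N : (arc_length c 0 1 <= (P N 1 + E N 1)%:E)%E.
Proof.
have := arc_length_le_primitive prc1 prc2 (primitive_onD (primP N) (primE N)).
rewrite P0 E0 addr0 subr0; apply => t t01; rewrite speedE//.
have := ler_norm (K * (1 + t) `^ (- al) * q t - p' N t).
by have := speed_err N t01; rewrite -/(q t); lra.
Qed.

Let arc_ge N : ((P N 1 - E N 1)%:E <= arc_length c 0 1)%E.
Proof.
have := primitive_le_arc_length prc1 prc2 ltr01 (primitive_onB (primP N) (primE N)).
rewrite P0 E0 subr0 subr0; apply => t t01; rewrite speedE//.
have := ler_norm (- (K * (1 + t) `^ (- al) * q t - p' N t)); rewrite normrN.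
by have := speed_err N t01; rewrite -/(q t); lra.
Qed.

Let arc_fin : arc_length c 0 1 \is a fin_num.
Proof.
by rewrite fin_numElt (lt_le_trans _ (arc_ge 0)) ?ltNyr// (le_lt_trans (arc_le 0)) ?ltry.
Qed.

(** Only [N] goes to infinity here. At [t = 1] the third part of [E N] vanishes in the limit because
    [z < 1]; the other two form the bound, in which [e] and [n] are still free. *)
Lemma arc_length_estimate : arc_length c 0 1 \is a fin_num /\
  `|fine (arc_length c 0 1) - K * S * arc_sum e n| <=
  K * S * (al * (1 - e) / (mu + 1) + binom_coef al n * e ^+ n / (n%:R + mu)).
Proof.
split; first exact: arc_fin.
set L := fine _.
have LP N : `|L - P N 1| <= E N 1.
  rewrite ler_distl; apply/andP; split; rewrite -lee_fin fineK ?arc_fin//.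
set l := K * S * _; set b := leRHS.
have z01 : 0 <= z < 1.
  have AB0 : 0 < A + B by rewrite addr_gt0.
  rewrite divr_ge0 ?(ltW B_gt0) ?(ltW AB0)//= ltr_pdivrMr// mul1r ltrDr//.
have Pl : P N 1 @[N --> \oo] --> l.
  rewrite /l /arc_sum mulr_sumr.
  apply: (@cvg_sum_ord n (fun k N => T N k 1)
    (fun k => K * S * ((- e) ^+ k * binom_coef al k * (F k / (k%:R + mu))))) => k _.
  have -> : K * S * ((- e) ^+ k * binom_coef al k * (F k / (k%:R + mu))) =
      K * (- e) ^+ k * binom_coef al k * (S / (k%:R + mu) * F k).
    by move: (binom_coef _ _) => x; ring.
  rewrite /T.
  apply: cvgMl_tmp.
  under eq_cvg do rewrite approx_primitive1//.
  apply: cvgMl_tmp; rewrite (cvg_shiftS (series _)).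
  have [] // := @abs_cvg_gauss_Nhalf1 R ((k%:R + mu) / w + 1) z.
  by rewrite lerDr divr_ge0 ?ltW.
have Eb : E N 1 @[N --> \oo] --> b.
  rewrite /E /b -[X in _ --> X]addr0; apply: cvgD.
    rewrite !powR1 !mulr1 -mulrA -(mulrA (K * S)) -mulrDr; exact: cvg_cst.
  rewrite [X in _ --> X](_ : 0 = \sum_(k < n) 0); last by rewrite big1.
  apply: (@cvg_sum_ord n (fun k N => r k N * ((k%:R + mu)^-1 * 1 `^ (k%:R + mu))) (fun=> 0)) => k _.
  rewrite -[X in _ --> X](mul0r ((k%:R + mu)^-1 * 1 `^ (k%:R + mu))); apply: cvgMr_tmp.
  rewrite -[X in _ --> X](mulr0 (K * binom_coef al k)); apply: cvgMl_tmp.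
  rewrite -[X in _ --> X](mulr0 (S / (2 * ((k%:R + mu) / w)))); apply: cvgMl_tmp.
  rewrite (cvg_shiftS (fun N => z ^+ N)); apply: cvg_expr.
  by case/andP: z01 => z0 z1; rewrite ger0_norm.
apply: ler_cvg_to (cvg_norm (cvgB (cvg_cst L) Pl)) Eb _.
by apply: nearW => N; exact: LP.
Qed.

End estimate.

End half_arc.

(** * Parametrization of the superellipse *)

Section arc_symmetry.
Context {R : realType}.
Implicit Types (c g : R -> R * R) (h x y : R).

Lemma arc_length_shift c g h x y :
  (forall p q, euclid_dist (c (p + h)) (c (q + h)) = euclid_dist (g p) (g q)) ->
  arc_length c (x + h) (y + h) = arc_length g x y.
Proof.
move=> cg; apply/le_anti/andP; split.
  have := @arc_length_iso R c g (fun t => t - h) (x + h) (y + h).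
  rewrite !addrK; apply=> [p q _ pq _|p q _ _ _]; first by rewrite ltrD2r.
  by rewrite -cg !subrK.
apply: (@arc_length_iso R g c (fun t => t + h)) => [p q _ pq _|p q _ _ _].
  by rewrite ltrD2r.
by rewrite cg.
Qed.

Lemma arc_length_reflect c g h x y :
  (forall p q, euclid_dist (c (h - p)) (c (h - q)) = euclid_dist (g p) (g q)) ->
  arc_length c (h - y) (h - x) = arc_length g x y.
Proof.
move=> cg; apply/le_anti/andP; split.
  have := @arc_length_antiiso R c g (fun t => h - t) (h - y) (h - x).
  rewrite !subKr; apply=> [p q _ pq _|p q _ _ _]; first by rewrite ltrD2l ltrN2.
  by rewrite -cg !subKr.
apply: (@arc_length_antiiso R g c (fun t => h - t)) => [p q _ pq _|p q _ _ _].
  by rewrite ltrD2l ltrN2.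
by rewrite cg.
Qed.

(** Made for a quarter turn [h]: it exchanges the superellipses of [(a, b)] and [(b, a)], so the
    four quarters alternate between them. *)
Lemma arc_length_alternate c g h : 0 <= h ->
  (forall x y, arc_length c (x + h) (y + h) = arc_length g x y) ->
  (forall x y, arc_length g (x + h) (y + h) = arc_length c x y) ->
  arc_length c 0 (h + h + (h + h)) =
  (arc_length c 0 h + arc_length g 0 h + (arc_length c 0 h + arc_length g 0 h))%E.
Proof.
move=> h0 cg gc.
have cE : arc_length c h (h + h) = arc_length g 0 h by rewrite -(cg 0 h) add0r.
have ccE : arc_length c (h + h) (h + h + (h + h)) = arc_length c 0 (h + h).
  by rewrite -(gc 0 (h + h)) -(cg (0 + h) (h + h + h)) add0r addrA.
rewrite (@arc_length_cat R _ 0 (h + h)) ?ccE; last by lra.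
by rewrite (@arc_length_cat R _ 0 h (h + h)) ?cE; last by lra.
Qed.

End arc_symmetry.

Section superellipse_arcs.
Context {R : realType}.
Implicit Types (s a b t v : R).

Lemma superellipse_radius_shift s a b t :
  superellipse_radius s a b (t + pi / 2) = superellipse_radius s b a t.
Proof.
rewrite /superellipse_radius.
have -> : cos (t + pi / 2) = - sin t := cosDpihalf t.
have -> : sin (t + pi / 2) = cos t := sinDpihalf t.
by rewrite normrN [X in X `^ _]addrC.
Qed.

Lemma superellipse_shiftE s a b t : superellipse s a b (t + pi / 2) =
  (- (superellipse s b a t).2, (superellipse s b a t).1).
Proof.
rewrite /superellipse superellipse_radius_shift/=.
move: (superellipse_radius _ _ _ _) => r.
have -> : cos (t + pi / 2) = - sin t := cosDpihalf t.
have -> : sin (t + pi / 2) = cos t := sinDpihalf t.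
by rewrite mulrN.
Qed.

Lemma superellipse_shift s a b p q :
  euclid_dist (superellipse s a b (p + pi / 2)) (superellipse s a b (q + pi / 2)) =
  euclid_dist (superellipse s b a p) (superellipse s b a q).
Proof.
by rewrite !superellipse_shiftE /euclid_dist/= -opprD sqrrN addrC.
Qed.

Lemma superellipse_reflectE s a b t : superellipse s a b (pi / 2 - t) =
  ((superellipse s b a t).2, (superellipse s b a t).1).
Proof.
rewrite /superellipse /superellipse_radius (addrC (pi / 2)) (cosDpihalf (- t)) (sinDpihalf (- t)).
by rewrite cosN sinN opprK [X in X `^ _]addrC.
Qed.

Lemma superellipse_reflect s a b p q :
  euclid_dist (superellipse s a b (pi / 2 - p)) (superellipse s a b (pi / 2 - q)) =
  euclid_dist (superellipse s b a p) (superellipse s b a q).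
Proof. by rewrite !superellipse_reflectE /euclid_dist/= addrC. Qed.

Definition lame_arc s a b v : R * R :=
  (a * (1 + v) `^ (- s^-1), b * (v `^ (s^-1) * (1 + v) `^ (- s^-1))).

Lemma tan_ge0 t : 0 <= t < pi / 2 -> 0 <= tan t.
Proof.
have pih : 0 < pi / 2 :> R by rewrite divr_gt0// pi_gt0.
move=> /andP[t0 t1]; rewrite divr_ge0//; last first.
  by apply/ltW/cos_gt0_pihalf; rewrite t1 (lt_le_trans _ t0)// oppr_lt0.
apply: sin_ge0_pi; rewrite t0 (le_trans (ltW t1))//.
by have := @pi_gt0 R; lra.
Qed.

Lemma superellipse_lame_arc s a b t : 0 < s -> 0 < a -> 0 < b -> 0 <= t < pi / 2 ->
  superellipse s a b t = lame_arc s a b ((a / b * tan t) `^ s).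
Proof.
move=> s0 a0 b0 /andP[t0 t1].
have c0 : 0 < cos t.
  apply: cos_gt0_pihalf; rewrite t1 (lt_le_trans _ t0)// oppr_lt0.
  by rewrite divr_gt0// pi_gt0.
have s0' : 0 <= sin t.
  by apply: sin_ge0_pi; rewrite t0 (le_trans (ltW t1))// ler_pdivrMr// ler_peMr ?pi_ge0// ler1n.
rewrite /superellipse /superellipse_radius /lame_arc.
set X := a / b * tan t.
have X0 : 0 <= X by rewrite !mulr_ge0// ?invr_ge0 ltW.
(* Factoring out (cos t / a)^s leaves a function of the new parameter alone; the power [- s^-1] then
   cancels the cosine. *)
have -> : `|cos t| `^ s / a `^ s + `|sin t| `^ s / b `^ s = (cos t / a) `^ s * (1 + X `^ s).
  rewrite (gtr0_norm c0) (ger0_norm s0').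
  have -> : sin t = cos t / a * X * b by rewrite /X /tan; field; rewrite !gt_eqF.
  rewrite !powRM ?mulr_ge0 ?invr_ge0 ?(ltW c0) ?(ltW a0) ?(ltW b0)//.
  have -> : a^-1 `^ s = (a `^ s)^-1 by rewrite -powR_inv1 ?(ltW a0)// -powRrM mulN1r powRN.
  by field; rewrite !gt_eqF ?powR_gt0.
have XS : 0 <= 1 + X `^ s by rewrite addr_ge0 ?powR_ge0.
rewrite powRM ?powR_ge0// -powRrM mulrN mulfV ?gt_eqF// powR_inv1; last first.
  by rewrite divr_ge0 ?(ltW c0) ?(ltW a0).
rewrite -powRrM mulfV ?gt_eqF// powRr1// /X /tan.
by congr pair; field; rewrite !gt_eqF.
Qed.

(** Inscribed polygons see only the order of the points, so a strictly increasing change of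
    parameter preserves length whatever its smoothness. The change of parameter and its inverse give
    one inequality each. *)
Lemma arc_length_lame_arc s a b : 0 < s -> 0 < a -> 0 < b ->
  arc_length (superellipse s a b) 0 (atan (b / a)) = arc_length (lame_arc s a b) 0 1.
Proof.
move=> s0 a0 b0; have ab0 : 0 < a / b by rewrite divr_gt0.
have ba0 : 0 < b / a by rewrite divr_gt0.
have sE := superellipse_lame_arc s0 a0 b0.
have at_lt v : atan v < pi / 2 := atan_ltpi2 v.
have h0 : (a / b * tan 0) `^ s = 0 by rewrite tan0 mulr0 powR0// gt_eqF.
have h1 : (a / b * tan (atan (b / a))) `^ s = 1.
  by rewrite atanK (_ : a / b * (b / a) = 1) ?powR1//; field; rewrite !gt_eqF.
have k0 : atan (b / a * 0 `^ s^-1) = 0 by rewrite powR0 ?gt_eqF ?invr_gt0// mulr0 atan0.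
have k1 : atan (b / a * 1 `^ s^-1) = atan (b / a) by rewrite powR1 mulr1.
have pih : 0 < pi / 2 :> R by rewrite divr_gt0// pi_gt0.
apply/le_anti/andP; split.
  have := @arc_length_iso R (superellipse s a b) (lame_arc s a b)
    (fun t => (a / b * tan t) `^ s) 0 (atan (b / a)).
  rewrite h0 h1; apply=> [p q p0 pq q1|p q p0 pq q1].
    have q2 := le_lt_trans q1 (at_lt _).
    have itv t : p <= t -> t <= q -> t \in `](- (pi / 2)), (pi / 2)[.
      move=> pt tq; rewrite in_itv/= (le_lt_trans tq)// (lt_le_trans _ pt)//.
      by rewrite (lt_le_trans _ p0)// oppr_lt0.
    have tp : 0 <= tan p by rewrite tan_ge0// p0 (lt_trans pq).
    have tpq : tan p < tan q by rewrite ltr_tan ?itv ?(ltW pq).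
    apply: gt0_ltr_powR; rewrite ?nnegrE ?(mulr_ge0 (ltW ab0)) ?(le_trans tp (ltW tpq))//.
    by rewrite ltr_pM2l.
  have q2 := le_lt_trans q1 (at_lt _).
  by rewrite !sE// ?(le_trans p0 pq)//= p0 (le_lt_trans pq).
have := @arc_length_iso R (lame_arc s a b) (superellipse s a b)
  (fun v => atan (b / a * v `^ s^-1)) 0 1.
rewrite k0 k1; apply.
  move=> p q p0 pq _; apply: lt_atan; rewrite ltr_pM2l//.
  by apply: gt0_ltr_powR; rewrite ?nnegrE ?invr_gt0 ?(le_trans p0 (ltW pq)).
have lE v : 0 <= v -> superellipse s a b (atan (b / a * v `^ s^-1)) = lame_arc s a b v.
  move=> v0; rewrite sE ?at_lt ?andbT; last first.
    by rewrite -atan0; apply: le_atan; rewrite mulr_ge0 ?powR_ge0// ltW.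
  congr (lame_arc s a b _); rewrite atanK mulrA.
  rewrite (_ : a / b * (b / a) = 1) ?mul1r; last by field; rewrite !gt_eqF.
  by rewrite -powRrM mulVf ?powRr1// gt_eqF.
by move=> p q p0 pq _; rewrite !lE// (le_trans p0).
Qed.

(** Reflection in the diagonal sends the remaining arc to the first arc of [(b, a)]; the angles
    match because [atan (a / b)] and [atan (b / a)] add up to [pi / 2]. *)
Lemma arc_length_quarter s a b : 0 < s -> 0 < a -> 0 < b ->
  arc_length (superellipse s a b) 0 (pi / 2) =
  (arc_length (lame_arc s a b) 0 1 + arc_length (lame_arc s b a) 0 1)%E.
Proof.
move=> s0 a0 b0; have ba0 : 0 < b / a by rewrite divr_gt0.
have at0 : 0 < atan (b / a) by rewrite -atan0; apply: lt_atan.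
rewrite (@arc_length_cat R _ 0 (atan (b / a))); last by rewrite !ltW// atan_ltpi2.
rewrite arc_length_lame_arc//; congr (_ + _)%E.
rewrite -arc_length_lame_arc//.
have c0 : cos (atan (b / a)) != 0.
  by rewrite gt_eqF// cos_gt0_pihalf// atan_gtNpi2 atan_ltpi2.
have tE : tan (pi / 2 - atan (b / a)) = a / b.
  rewrite /tan (addrC (pi / 2)) (cosDpihalf (- _)) (sinDpihalf (- _)).
  rewrite sinN cosN opprK -[RHS]invf_div -[in RHS](atanK (b / a)).
  by rewrite /tan invf_div.
have atE : pi / 2 - atan (a / b) = atan (b / a).
  rewrite -tE tanK ?subKr// in_itv/= ltrBlDr ltrDl at0 andbT.
  by have := @atan_ltpi2 R (b / a); have := @pi_gt0 R; lra.
have := arc_length_reflect 0 (atan (a / b)) (superellipse_reflect s a b).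
by rewrite subr0 atE.
Qed.

Lemma perimeter_lame_arc s a b : 0 < s -> 0 < a -> 0 < b ->
  perimeter s a b =
  ((arc_length (lame_arc s a b) 0 1 + arc_length (lame_arc s b a) 0 1) +
   (arc_length (lame_arc s a b) 0 1 + arc_length (lame_arc s b a) 0 1) +
   ((arc_length (lame_arc s a b) 0 1 + arc_length (lame_arc s b a) 0 1) +
   (arc_length (lame_arc s a b) 0 1 + arc_length (lame_arc s b a) 0 1)))%E.
Proof.
move=> s0 a0 b0.
have sh a' b' x y := arc_length_shift x y (superellipse_shift s a' b').
have twopi : 2 * pi = (pi / 2 + pi / 2) + (pi / 2 + pi / 2) :> R.
  by rewrite -splitr mulr_natl mulr2n.
have pih0 : 0 <= pi / 2 :> R by rewrite divr_ge0// pi_ge0.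
rewrite /perimeter twopi (arc_length_alternate pih0 (sh a b) (sh b a)).
have ab := arc_length_quarter s0 a0 b0.
have ba := arc_length_quarter s0 b0 a0; rewrite addeC in ba.
by congr ((_ + _) + (_ + _))%E; [exact: ab|exact: ba|exact: ab|exact: ba].
Qed.

Lemma perimeter_sym s a b : 0 < s -> 0 < a -> 0 < b ->
  perimeter s a b = perimeter s b a.
Proof.
move=> s0 a0 b0; apply: (etrans (perimeter_lame_arc s0 a0 b0)).
apply: (etrans _ (esym (perimeter_lame_arc s0 b0 a0))).
move: (arc_length (lame_arc s a b) 0 1) (arc_length (lame_arc s b a) 0 1) => x y.
by rewrite (addeC x).
Qed.

End superellipse_arcs.

(** * Asymptotics of binomial coefficients *)

Section binom_coef_asymptotics.
Context {R : realType}.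
Implicit Types (al e mu r : R) (k n : nat).

Lemma binom_coefS_ratio al n :
  binom_coef al n.+1 = binom_coef al n * ((al + n%:R) / n.+1%:R).
Proof.
rewrite /binom_coef risingS_r factS natrM; field.
by rewrite nat1r !pnatr_eq0 -!lt0n fact_gt0.
Qed.

(** The ratio of consecutive terms, [(al + n) r / n.+1], is at most 1 once [n >= al r / (1 - r)]; up
    to there a finite sum bounds every term. *)
Lemma binom_coef_le_geometric al r : 0 < al -> 0 < r -> r < 1 ->
  exists M, forall n, binom_coef al n * r ^+ n <= M.
Proof.
move=> al0 r0 r1; pose v n := binom_coef al n * r ^+ n.
have v0 n : 0 <= v n by rewrite mulr_ge0 ?exprn_ge0// ltW// binom_coef_gt0.
pose K := Num.truncn (al * r / (1 - r)).
exists (\sum_(i < K.+2) v i); elim=> [|n IH].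
  by rewrite big_ord_recl/= lerDl sumr_ge0.
have [nK|Kn] := ltnP n.+1 K.+2.
  by rewrite (bigD1 (Ordinal nK))//= lerDl sumr_ge0.
apply: le_trans IH; rewrite binom_coefS_ratio exprS.
rewrite (_ : _ * _ = v n * ((al + n%:R) * r / n.+1%:R)); last by rewrite /v; ring.
rewrite ler_piMr// ler_pdivrMr ?ltr0n// mul1r.
have : al * r / (1 - r) <= n%:R.
  apply: le_trans (ltW (truncnS_gt _)) _; rewrite ler_nat; exact: Kn.
rewrite ler_pdivrMr ?subr_gt0// -natr1; nra.
Qed.

Lemma binom_coef_expr_le al e : 0 < al -> 0 < e -> e < 1 ->
  exists M r, [/\ 0 < r, r < 1 & forall n, binom_coef al n * e ^+ n <= M * r ^+ n].
Proof.
(* Halfway between [e] and 1: the coefficients are bounded by a multiple of [(r / e) ^+ n], which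
   leaves the decay [r ^+ n]. *)
move=> al0 e0 e1; pose r := (1 + e) / 2.
have r0 : 0 < r by rewrite /r; lra.
have er : e < r by rewrite /r; lra.
have [|||M hM] := @binom_coef_le_geometric al (e / r) => //.
- exact: divr_gt0.
- by rewrite ltr_pdivrMr// mul1r.
exists M, r; split=> // [|n]; first by rewrite /r; lra.
have := hM n; rewrite expr_div_n mulrA ler_pdivrMr ?exprn_gt0//.
Qed.

Lemma cvg_binom_coef_expr al e : 0 < al -> 0 < e -> e < 1 ->
  binom_coef al n * e ^+ n @[n --> \oo] --> 0.
Proof.
move=> al0 e0 e1; have [M [r [r0 r1 hM]]] := binom_coef_expr_le al0 e0 e1.
apply: (@squeeze_cvgr _ _ _ _ (cst 0) (fun n => M * r ^+ n)).
- apply: nearW => n; rewrite hM andbT mulr_ge0 ?exprn_ge0 ?(ltW e0)//.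
  exact/ltW/binom_coef_gt0.
- exact: cvg_cst.
- rewrite -[X in _ --> X](mulr0 M); apply: cvgMl_tmp; apply: cvg_expr.
  by rewrite gtr0_norm.
Qed.

(* The terms decrease to a limit [l]; consecutive differences are
   [(1 - mu) / n.+1] times a term, so [l > 0] would make the harmonic series
   converge. *)
Lemma cvg_binom_coef_div mu : 0 < mu -> mu < 1 ->
  binom_coef (1 + mu) n / (n%:R + mu) @[n --> \oo] --> 0.
Proof.
move=> mu0 mu1; pose a n := binom_coef (1 + mu) n / (n%:R + mu).
have al0 : 0 < 1 + mu by lra.
have nmu n : 0 < n%:R + mu by rewrite ltr_wpDl.
have a0 n : 0 < a n by rewrite divr_gt0// binom_coef_gt0.
have aB n : a n - a n.+1 = (1 - mu) * (a n * n.+1%:R^-1).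
  rewrite /a binom_coefS_ratio -natr1; field.
  by rewrite natr1 !gt_eqF//= -?natr1 ?addr_gt0//; have := ler0n R n; lra.
have aS n : a n.+1 <= a n.
  rewrite -subr_ge0 aB mulr_ge0 ?subr_ge0 ?(ltW mu1)//.
  by rewrite mulr_ge0 ?(ltW (a0 n)) ?invr_ge0.
have lb : has_lbound (range a) by exists 0 => _ [n _ <-]; exact: ltW.
have nia : nonincreasing_seq a by exact/nonincreasing_seqP.
have ca := nonincreasing_is_cvgn nia lb.
have al n := nonincreasing_cvgn_ge nia ca n.
have : 0 <= limn a by apply: limr_ge => //; apply: nearW => n; exact: ltW.
rewrite le_eqVlt => /predU1P[l0|l0]; first by rewrite {1}l0.
have [] := @dvg_harmonic R.
apply: (@series_le_cvg _ _ (fun n => ((1 - mu) * limn a)^-1 * (a n - a n.+1))) => [n|n|n|].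
- by rewrite /harmonic/= invr_ge0.
- by rewrite mulr_ge0 ?subr_ge0// invr_ge0 mulr_ge0 ?subr_ge0 ?ltW.
- rewrite aB [leRHS](_ : _ = a n / limn a * n.+1%:R^-1).
    by rewrite ler_peMl ?invr_ge0// ler_pdivlMr// mul1r; exact: al.
  by field; rewrite nat1r pnatr_eq0 !gt_eqF ?subr_gt0.
- have -> : series (fun n => ((1 - mu) * limn a)^-1 * (a n - a n.+1)) =
      (fun n => ((1 - mu) * limn a)^-1 * (a 0%N - a n)).
    apply/funext => n; rewrite /series/= -mulr_sumr; congr (_ * _).
    by rewrite -[RHS]opprB -telescope_sumr// -sumrN; apply: eq_bigr => i _; rewrite opprB.
  by apply: is_cvgMl_tmp; apply: is_cvgB => //; exact: is_cvg_cst.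
Qed.

End binom_coef_asymptotics.

(** * Derivatives and speed of the Lamé arc *)

Section lame_arc_length.
Context {R : realType}.
Implicit Types (s a b t : R).

Lemma primitive_on_lame_arc1 s a b : 0 < s ->
  primitive_on (fun t => (lame_arc s a b t).1)
    (fun t => - (a / s) * (1 + t) `^ (- (1 + s^-1))) 0 1.
Proof.
move=> s0.
have d t : 0 <= t ->
    is_derive t 1 (fun t => (1 + t) `^ (- s^-1)) (- s^-1 * (1 + t) `^ (- s^-1 - 1)).
  move=> t0; have t10 : 0 < 1 + t by lra.
  have := is_derive_powR_comp (- s^-1) (is_derive_1D t) t10.
  by rewrite mulr1.
have pr : primitive_on (fun t => (1 + t) `^ (- s^-1))
    (fun t => - s^-1 * (1 + t) `^ (- s^-1 - 1)) 0 1.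
  split=> [|t /andP[t0 _]]; last exact/d/ltW.
  apply: derivable_within_continuous => t; rewrite in_itv/= => /andP[t0 _].
  by have [] := d t t0.
apply: primitive_on_ext (primitive_onZ a pr) => t _.
by rewrite (_ : - s^-1 - 1 = - (1 + s^-1)); ring.
Qed.

Lemma primitive_on_lame_arc2 s a b : 0 < s ->
  primitive_on (fun t => (lame_arc s a b t).2)
    (fun t => b / s * t `^ (s^-1 - 1) * (1 + t) `^ (- (1 + s^-1))) 0 1.
Proof.
move=> s0; have si0 : 0 < s^-1 by rewrite invr_gt0.
have d t : 0 < t -> is_derive t 1 (fun t => t `^ s^-1 * (1 + t) `^ (- s^-1))
    (s^-1 * t `^ (s^-1 - 1) * (1 + t) `^ (- (1 + s^-1))).
  move=> t0; have t10 : 0 < 1 + t by lra.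
  have := is_derive_mulr (is_derive1_powR s^-1 t0)
    (is_derive_powR_comp (- s^-1) (is_derive_1D t) t10).
  congr is_derive; rewrite mulr1.
  rewrite (_ : - s^-1 - 1 = - (1 + s^-1)); last by ring.
  (* Both terms are brought to the exponents [s^-1 - 1] and [- (1 + s^-1)]; the bracket left over is
     [(1 + t) - t = 1]. *)
  rewrite -{1}(mulr_powRB1 (ltW t0) si0).
  have <- : (1 + t) * (1 + t) `^ (- (1 + s^-1)) = (1 + t) `^ (- s^-1).
    rewrite (_ : - (1 + s^-1) = - s^-1 - 1); last by ring.
    by rewrite powRB ?(gt_eqF t10) ?implybT// powRr1 ?(ltW t10)// mulrC divfK// gt_eqF.
  by ring.
have pr : primitive_on (fun t => t `^ s^-1 * (1 + t) `^ (- s^-1))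
    (fun t => s^-1 * t `^ (s^-1 - 1) * (1 + t) `^ (- (1 + s^-1))) 0 1.
  split=> [|t /andP[t0 _]]; last exact: d.
  apply: continuous_within01 => [t t0|]; first by have [] := d t t0.
  have c0 : {for 0, continuous (fun t : R => (1 + t) `^ (- s^-1))}.
    apply/differentiable_continuous/derivable1_diffP.
    by have [] := is_derive_powR_comp (- s^-1) (is_derive_1D 0) (ltr_wpDr (lexx 0) ltr01).
  rewrite powR0 ?gt_eqF// mul0r -[X in _ --> X](mul0r ((1 + 0) `^ (- s^-1))).
  by apply: cvgM; [exact: powR_cvg0|exact/cvg_at_right_filter/c0].
by apply: primitive_on_ext (primitive_onZ b pr) => t _; ring.
Qed.

Lemma lame_arc_speed s a b t : 0 < s ->
  Num.sqrt ((- (a / s) * (1 + t) `^ (- (1 + s^-1))) ^+ 2 +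
    (b / s * t `^ (s^-1 - 1) * (1 + t) `^ (- (1 + s^-1))) ^+ 2) =
  s^-1 * (1 + t) `^ (- (1 + s^-1)) *
  Num.sqrt (a ^+ 2 + b ^+ 2 * t `^ (2 * (s^-1 - 1))).
Proof.
move=> s0.
have -> : t `^ (2 * (s^-1 - 1)) = (t `^ (s^-1 - 1)) ^+ 2.
  by rewrite mulrC powRrM powR_mulrn ?powR_ge0.
have K0 : 0 <= s^-1 * (1 + t) `^ (- (1 + s^-1)) by rewrite mulr_ge0 ?powR_ge0 ?invr_ge0 ?ltW.
rewrite -[X in X * Num.sqrt _](ger0_norm K0) -sqrtr_sqr -sqrtrM ?sqr_ge0//.
by congr Num.sqrt; ring.
Qed.

(** Meant for [s > 1], where the exponent on the left is negative: the moment lemmas require a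
    positive [w]. *)
Lemma lame_arc_speed_factor s a b t : 0 < t ->
  Num.sqrt (a ^+ 2 + b ^+ 2 * t `^ (2 * (s^-1 - 1))) =
  t `^ (s^-1 - 1) * Num.sqrt (b ^+ 2 + a ^+ 2 * t `^ (2 * (1 - s^-1))).
Proof.
move=> t0; have p0 := powR_gt0 (s^-1 - 1) t0.
rewrite -[X in X * Num.sqrt _](gtr0_norm p0) -sqrtr_sqr -sqrtrM ?sqr_ge0//.
congr Num.sqrt; rewrite -(opprB s^-1 1) mulrN powRN.
rewrite (mulrC 2) powRrM powR_mulrn ?powR_ge0//; field.
by rewrite gt_eqF.
Qed.

End lame_arc_length.

(** * Perimeter *)

Section perimeter_series.
Context {R : realType}.
Implicit Types (s a b e mu w X C D : R) (u t : nat -> R).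

(** The moment denominators [k + mu] equal [w * u k], whence the factor [w^-1]. The two arcs
    exchange [A] and [B], which makes the bracket symmetric. *)
Lemma arc_sumD_perimeter_term s a b mu w u e n :
  0 < s -> 0 < mu -> 0 < w -> (forall k, u k = (k%:R + mu) / w) ->
  arc_sum (a ^+ 2) (b ^+ 2) mu w (1 + s^-1) e n +
  arc_sum (b ^+ 2) (a ^+ 2) mu w (1 + s^-1) e n =
  w^-1 * series (fun k => perimeter_term u s a b k * e ^+ k) n.
Proof.
move=> s0 mu0 w0 uE; have al0 : 0 < 1 + s^-1 by rewrite addr_gt0 ?invr_gt0.
rewrite /arc_sum /series/= big_mkord mulr_sumr -big_split/=; apply: eq_bigr => k _.
rewrite /perimeter_term -uE pochhammer_gt0E// (addrC (b ^+ 2) (a ^+ 2)).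
rewrite exprNn uE /binom_coef; field.
by rewrite (gt_eqF w0) gt_eqF ?ltr_wpDl// pnatr_eq0 -lt0n fact_gt0.
Qed.

Lemma lame_arc_estimate_gt1 s a b : 1 < s -> 0 < a -> 0 < b ->
  arc_length (lame_arc s a b) 0 1 \is a fin_num /\
  forall e n, 0 < e -> e <= 1 ->
  `|fine (arc_length (lame_arc s a b) 0 1) - s^-1 * Num.sqrt (a ^+ 2 + b ^+ 2) *
     arc_sum (b ^+ 2) (a ^+ 2) s^-1 (2 * (1 - s^-1)) (1 + s^-1) e n| <=
  s^-1 * Num.sqrt (a ^+ 2 + b ^+ 2) *
    ((1 + s^-1) * (1 - e) / (s^-1 + 1) + binom_coef (1 + s^-1) n * e ^+ n / (n%:R + s^-1)).
Proof.
move=> s1 a0 b0; have s0 : 0 < s := lt_trans ltr01 s1.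
have si0 : 0 < s^-1 by rewrite invr_gt0.
have si1 : s^-1 < 1 by rewrite invf_lt1.
have w0 : 0 < 2 * (1 - s^-1) by rewrite mulr_gt0// subr_gt0.
have al0 : 0 < 1 + s^-1 by rewrite addr_gt0.
have sp (t : R) : 0 < t < 1 -> Num.sqrt ((- (a / s) * (1 + t) `^ (- (1 + s^-1))) ^+ 2 +
    (b / s * t `^ (s^-1 - 1) * (1 + t) `^ (- (1 + s^-1))) ^+ 2) = s^-1 * (1 + t) `^ (- (1 + s^-1)) *
    (t `^ (s^-1 - 1) * Num.sqrt (b ^+ 2 + a ^+ 2 * t `^ (2 * (1 - s^-1)))).
  by move=> /andP[t0 _]; rewrite -lame_arc_speed_factor// lame_arc_speed.
have A0 := exprn_gt0 2 b0; have B0 := exprn_gt0 2 a0.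
have pr1 := primitive_on_lame_arc1 a b s0; have pr2 := primitive_on_lame_arc2 a b s0.
rewrite (addrC (a ^+ 2)); have est := arc_length_estimate A0 B0 si0 w0 si0 al0 pr1 pr2 sp.
split; first by have [] := est 1 0 ltr01 (lexx 1).
by move=> e n e0 e1; have [] := est e n e0 e1.
Qed.

Lemma lame_arc_estimate_lt1 s a b : 0 < s -> s < 1 -> 0 < a -> 0 < b ->
  arc_length (lame_arc s a b) 0 1 \is a fin_num /\
  forall e n, 0 < e -> e <= 1 ->
  `|fine (arc_length (lame_arc s a b) 0 1) - s^-1 * Num.sqrt (a ^+ 2 + b ^+ 2) *
     arc_sum (a ^+ 2) (b ^+ 2) 1 (2 * (s^-1 - 1)) (1 + s^-1) e n| <=
  s^-1 * Num.sqrt (a ^+ 2 + b ^+ 2) *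
    ((1 + s^-1) * (1 - e) / (1 + 1) + binom_coef (1 + s^-1) n * e ^+ n / (n%:R + 1)).
Proof.
move=> s0 s1 a0 b0.
have si0 : 0 < s^-1 by rewrite invr_gt0.
have si1 : 1 < s^-1 by rewrite invf_gt1.
have w0 : 0 < 2 * (s^-1 - 1) by rewrite mulr_gt0// subr_gt0.
have al0 : 0 < 1 + s^-1 by rewrite addr_gt0.
have sp (t : R) : 0 < t < 1 -> Num.sqrt ((- (a / s) * (1 + t) `^ (- (1 + s^-1))) ^+ 2 +
    (b / s * t `^ (s^-1 - 1) * (1 + t) `^ (- (1 + s^-1))) ^+ 2) = s^-1 * (1 + t) `^ (- (1 + s^-1)) *
    (t `^ (1 - 1) * Num.sqrt (a ^+ 2 + b ^+ 2 * t `^ (2 * (s^-1 - 1)))).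
  by rewrite subrr powRr0 mul1r lame_arc_speed.
have A0 := exprn_gt0 2 a0; have B0 := exprn_gt0 2 b0.
have pr1 := primitive_on_lame_arc1 a b s0; have pr2 := primitive_on_lame_arc2 a b s0.
have est := arc_length_estimate A0 B0 ltr01 w0 si0 al0 pr1 pr2 sp.
split; first by have [] := est 1 0 ltr01 (lexx 1).
by move=> e n e0 e1; have [] := est e n e0 e1.
Qed.

Lemma perimeterE s a b : 0 < s -> 0 < a -> 0 < b ->
  arc_length (lame_arc s a b) 0 1 \is a fin_num ->
  arc_length (lame_arc s b a) 0 1 \is a fin_num ->
  perimeter s a b = (4 * (fine (arc_length (lame_arc s a b) 0 1) +
    fine (arc_length (lame_arc s b a) 0 1)))%:E.
Proof.
move=> s0 a0 b0; rewrite perimeter_lame_arc//.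
move: (arc_length (lame_arc s a b) 0 1) (arc_length (lame_arc s b a) 0 1).
move=> [x| |] [y| |]// _ _; rewrite -!EFinD/=; congr EFin; ring.
Qed.

Lemma perimeter_estimate_gt1 s a b : 1 < s -> 0 < a -> 0 < b ->
  exists2 X, perimeter s a b = (4 * X)%:E & forall n,
  `|X - Num.sqrt (a ^+ 2 + b ^+ 2) / (2 * (s - 1)) *
      series (perimeter_term (u_plus s) s a b) n| <=
  2 * (s^-1 * Num.sqrt (a ^+ 2 + b ^+ 2)) *
    (binom_coef (1 + s^-1) n / (n%:R + s^-1)).
Proof.
move=> s1 a0 b0; have s0 : 0 < s := lt_trans ltr01 s1.
have [fab hab] := lame_arc_estimate_gt1 s1 a0 b0.
have [fba hba] := lame_arc_estimate_gt1 s1 b0 a0.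
exists (fine (arc_length (lame_arc s a b) 0 1) + fine (arc_length (lame_arc s b a) 0 1)).
  exact: perimeterE.
(* At [e = 1] the shift error disappears and only the truncation error is left. *)
move=> n; have := hab 1 n ltr01 (lexx 1); have := hba 1 n ltr01 (lexx 1).
rewrite subrr mulr0 mul0r add0r expr1n mulr1 (addrC (b ^+ 2)).
have sm1 : s - 1 != 0 by rewrite subr_eq0 gt_eqF.
have w0 : 0 < 2 * (1 - s^-1) by rewrite mulr_gt0// subr_gt0 invf_lt1.
have uE k : u_plus s k = (k%:R + s^-1) / (2 * (1 - s^-1)).
  by rewrite /u_plus; field; rewrite gt_eqF.
have sumE := arc_sumD_perimeter_term a b 1 n s0 (_ : 0 < s^-1) w0 uE.
rewrite invr_gt0 in sumE; have {}sumE := sumE s0.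
have -> : series (perimeter_term (u_plus s) s a b) n =
    2 * (1 - s^-1) * (arc_sum (a ^+ 2) (b ^+ 2) s^-1 (2 * (1 - s^-1)) (1 + s^-1) 1 n +
    arc_sum (b ^+ 2) (a ^+ 2) s^-1 (2 * (1 - s^-1)) (1 + s^-1) 1 n).
  rewrite sumE mulrA mulfV ?gt_eqF// mul1r /series/=.
  by apply: eq_bigr => k _; rewrite expr1n mulr1.
move=> h1 h2.
set S := Num.sqrt _ in h1 h2 *; set x := arc_sum _ _ _ _ _ _ _ in h1 h2 *.
set y := arc_sum _ _ _ _ _ _ _ in h1 h2 *.
set L := fine _ in h1 h2 *; set M := fine _ in h1 h2 *; set b' := _ / _ in h1 h2 *.
have -> : S / (2 * (s - 1)) * (2 * (1 - s^-1) * (x + y)) = s^-1 * S * x + s^-1 * S * y.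
  by field; rewrite sm1 gt_eqF.
rewrite (_ : _ - _ = (L - s^-1 * S * x) + (M - s^-1 * S * y)); last by ring.
apply: le_trans (ler_normD _ _) _; lra.
Qed.

Lemma perimeter_estimate_lt1 s a b : 0 < s -> s < 1 -> 0 < a -> 0 < b ->
  exists2 X, perimeter s a b = (4 * X)%:E & forall e n, 0 < e -> e <= 1 ->
  `|X - Num.sqrt (a ^+ 2 + b ^+ 2) / (2 * (1 - s)) *
      series (fun k => perimeter_term (u_minus s) s a b k * e ^+ k) n| <=
  2 * (s^-1 * Num.sqrt (a ^+ 2 + b ^+ 2)) *
    ((1 + s^-1) * (1 - e) / (1 + 1) + binom_coef (1 + s^-1) n * e ^+ n / (n%:R + 1)).
Proof.
move=> s0 s1 a0 b0.
have [fab hab] := lame_arc_estimate_lt1 s0 s1 a0 b0.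
have [fba hba] := lame_arc_estimate_lt1 s0 s1 b0 a0.
exists (fine (arc_length (lame_arc s a b) 0 1) + fine (arc_length (lame_arc s b a) 0 1)).
  exact: perimeterE.
move=> e n e0 e1; have := hab e n e0 e1; have := hba e n e0 e1.
rewrite (addrC (b ^+ 2)).
have sm1 : 1 - s != 0 by rewrite subr_eq0 gt_eqF.
have w0 : 0 < 2 * (s^-1 - 1) by rewrite mulr_gt0// subr_gt0 invf_gt1.
have uE k : u_minus s k = (k%:R + 1) / (2 * (s^-1 - 1)).
  rewrite /u_minus -[k.+1%:R]natr1; field.
  by rewrite mulN1r sm1 gt_eqF.
have sumE := arc_sumD_perimeter_term a b e n s0 ltr01 w0 uE.
have -> : series (fun k => perimeter_term (u_minus s) s a b k * e ^+ k) n =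
    2 * (s^-1 - 1) * (arc_sum (a ^+ 2) (b ^+ 2) 1 (2 * (s^-1 - 1)) (1 + s^-1) e n +
    arc_sum (b ^+ 2) (a ^+ 2) 1 (2 * (s^-1 - 1)) (1 + s^-1) e n).
  by rewrite sumE mulrA mulfV ?gt_eqF// mul1r.
move=> h1 h2.
set S := Num.sqrt _ in h1 h2 *; set x := arc_sum _ _ _ _ _ _ _ in h1 h2 *.
set y := arc_sum _ _ _ _ _ _ _ in h1 h2 *.
set L := fine _ in h1 h2 *; set M := fine _ in h1 h2 *.
have -> : S / (2 * (1 - s)) * (2 * (s^-1 - 1) * (y + x)) = s^-1 * S * x + s^-1 * S * y.
  by field; rewrite ?mulN1r sm1 gt_eqF.
rewrite (_ : _ - _ = (L - s^-1 * S * x) + (M - s^-1 * S * y)); last by ring.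
apply: le_trans (ler_normD _ _) _; lra.
Qed.

(** Everything but the binomial coefficient is bounded uniformly in [n]: [u] is smallest at 0, and
    the hypergeometric bound is independent of the third parameter. *)
Lemma perimeter_term_le s a b u n : 0 < s -> 0 < a -> 0 < b ->
  (forall k, 0 < u 0%N <= u k) ->
  `|perimeter_term u s a b n| <= binom_coef (1 + s^-1) n *
    ((u 0%N)^-1 * ((1 - b ^+ 2 / (a ^+ 2 + b ^+ 2))^-1 + (1 - a ^+ 2 / (a ^+ 2 + b ^+ 2))^-1)).
Proof.
move=> s0 a0 b0 /(_ n)/andP[u0 uk].
have al0 : 0 < 1 + s^-1 by rewrite addr_gt0 ?invr_gt0.
have ab0 : 0 < a ^+ 2 + b ^+ 2 by rewrite addr_gt0 ?exprn_gt0.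
have un0 := lt_le_trans u0 uk.
have C1 : 1 <= u n + 1 by rewrite lerDr ltW.
have pE : perimeter_term u s a b n = (-1) ^+ n * (binom_coef (1 + s^-1) n * ((u n)^-1 *
    (hyp2F1 (- 2^-1) 1 (u n + 1) (b ^+ 2 / (a ^+ 2 + b ^+ 2)) +
     hyp2F1 (- 2^-1) 1 (u n + 1) (a ^+ 2 / (a ^+ 2 + b ^+ 2))))).
  rewrite /perimeter_term pochhammer_gt0E// /binom_coef; field.
  by rewrite (gt_eqF un0) pnatr_eq0 -lt0n fact_gt0.
have bc0 := binom_coef_gt0 n al0.
rewrite pE normrM normrX normrN1 expr1n mul1r normrM (gtr0_norm bc0).
rewrite ler_wpM2l ?(ltW bc0)// normrM normfV (gtr0_norm un0) ler_pM ?invr_ge0 ?(ltW un0)//.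
  by rewrite lef_pV2.
apply: le_trans (ler_normD _ _) _; apply: lerD; apply: normr_hyp2F1_Nhalf1 => //.
  by rewrite divr_ge0 ?sqr_ge0 ?(ltW ab0)//= ltr_pdivrMr// mul1r ltrDr exprn_gt0.
by rewrite divr_ge0 ?sqr_ge0 ?(ltW ab0)//= ltr_pdivrMr// mul1r ltrDl exprn_gt0.
Qed.

Lemma cvg_dist_le (T : Type) (F : set_system T) (FF : ProperFilter F) (f d : T -> R) (l : R) :
  (\forall x \near F, `|l - f x| <= d x) -> d x @[x --> F] --> 0 ->
  f x @[x --> F] --> l.
Proof.
move=> fd /cvgrPdist_le d0; apply/cvgrPdist_le => e e0; near=> x.
have h1 : `|l - f x| <= d x by near: x; exact: fd.
have h2 : `|0 - d x| <= e by near: x; exact: d0.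
by rewrite sub0r normrN in h2; exact: le_trans h1 (le_trans (ler_norm _) h2).
Unshelve. all: by end_near. Qed.

Lemma cvg_perimeter_term_gt1 s a b : 1 < s -> 0 < a -> 0 < b ->
  cvgn (series (perimeter_term (u_plus s) s a b)) /\
  perimeter s a b = (L_plus s a b)%:E.
Proof.
move=> s1 a0 b0; have s0 : 0 < s := lt_trans ltr01 s1.
have [X -> hX] := perimeter_estimate_gt1 s1 a0 b0.
set t := series _ in hX *; set S := Num.sqrt _ in hX.
have S0 : 0 < S by rewrite sqrtr_gt0 addr_gt0 ?exprn_gt0.
have sm1 : 0 < s - 1 by rewrite subr_gt0.
(* [4 * C] is the prefactor of [L_plus]. *)
set C := S / _ in hX; have C0 : 0 < C by rewrite divr_gt0 ?mulr_gt0.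
have tX : t @ \oo --> C^-1 * X.
  have CtX : C * t n @[n --> \oo] --> X.
    apply: (@cvg_dist_le _ _ _ _ (fun n => 2 * (s^-1 * S) *
      (binom_coef (1 + s^-1) n / (n%:R + s^-1)))); first exact: nearW.
    rewrite -[X in _ --> X](mulr0 (2 * (s^-1 * S))); apply: cvgMl_tmp.
    by apply: cvg_binom_coef_div; rewrite ?invr_gt0// invf_lt1.
  rewrite (_ : t = fun n => C^-1 * (C * t n)); first exact: cvgMl_tmp.
  by apply/funext => n; rewrite mulKf// gt_eqF.
split; first by apply/cvg_ex; exists (C^-1 * X).
rewrite /L_plus -/t -/S (cvg_lim _ tX)//; congr EFin.
by rewrite /C; field; rewrite (gt_eqF sm1) (gt_eqF S0).
Qed.

(** The order of the limits matters: at fixed [e < 1] the truncation error vanishes as [n] grows,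
    leaving an error of order [1 - e]. At [e = 1] the truncation bound does not tend to 0. *)
Lemma abel_perimeter_term_lt1 s a b : 0 < s -> s < 1 -> 0 < a -> 0 < b ->
  abel_summable (perimeter_term (u_minus s) s a b) /\
  perimeter s a b = (L_minus s a b)%:E.
Proof.
move=> s0 s1 a0 b0.
have [X -> hX] := perimeter_estimate_lt1 s0 s1 a0 b0.
have al0 : 0 < 1 + s^-1 by rewrite addr_gt0 ?invr_gt0.
set S := Num.sqrt _ in hX.
have S0 : 0 < S by rewrite sqrtr_gt0 addr_gt0 ?exprn_gt0.
have sm1 : 0 < 1 - s by rewrite subr_gt0.
set C := S / _ in hX; have C0 : 0 < C by rewrite divr_gt0 ?mulr_gt0.
pose f e k := perimeter_term (u_minus s) s a b k * e ^+ k.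
have u0 k : 0 < u_minus s 0 <= u_minus s k.
  rewrite /u_minus divr_gt0 ?mulr_gt0//= ler_wpM2r ?invr_ge0 ?mulr_ge0 ?(ltW sm1)//.
  by rewrite ler_wpM2l ?(ltW s0)// ler_nat.
have fcvg e : 0 < e < 1 -> cvgn (series (f e)).
  move=> /andP[e0 e1]; apply: normed_cvg.
  have [M [r [r0 r1 hM]]] := binom_coef_expr_le al0 e0 e1.
  have h k := perimeter_term_le k s0 a0 b0 u0; move: h; move: (_^-1 * _) => G h.
  apply: (@series_le_cvg _ _ (fun k => `|G| * `|M| * r ^+ k)) => [n|n|n|].
  - exact: normr_ge0.
  - by rewrite !mulr_ge0 ?exprn_ge0// ltW.
  - rewrite /f /= (normrM (perimeter_term _ _ _ _ n)) normrX (gtr0_norm e0).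
    apply: (@le_trans _ _ (binom_coef (1 + s^-1) n * `|G| * e ^+ n)).
      rewrite ler_wpM2r ?exprn_ge0 ?(ltW e0)//; apply: le_trans (h n) _.
      by rewrite ler_wpM2l ?ler_norm// ltW// binom_coef_gt0.
    rewrite mulrAC mulrC -mulrA ler_wpM2l// (le_trans (hM n))//.
    by rewrite ler_wpM2r ?ler_norm ?exprn_ge0// ltW.
  - by apply: is_cvg_geometric_series; rewrite gtr0_norm.
have lim_err e : 0 < e < 1 ->
    `|X - C * limn (series (f e))| <= 2 * (s^-1 * S) * ((1 + s^-1) * (1 - e) / (1 + 1) + 0).
  move=> e01; have /andP[e0 e1] := e01.
  have l1 : `|X - C * series (f e) n| @[n --> \oo] --> `|X - C * limn (series (f e))|.
    by apply: cvg_norm; apply: cvgB; [exact: cvg_cst|apply: cvgMl_tmp; exact: fcvg].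
  have l2 : 2 * (s^-1 * S) * ((1 + s^-1) * (1 - e) / (1 + 1) + binom_coef (1 + s^-1) n * e ^+ n)
      @[n --> \oo] --> 2 * (s^-1 * S) * ((1 + s^-1) * (1 - e) / (1 + 1) + 0).
    by apply: cvgMl_tmp; apply: cvgD; [exact: cvg_cst|exact: cvg_binom_coef_expr].
  apply: (ler_cvg_to l1 l2); apply: nearW => n.
  (* The denominator [n + 1] is dropped, since [e ^+ n] alone makes the term vanish. *)
  apply: le_trans (hX e n e0 (ltW e1)) _.
  rewrite ler_wpM2l ?mulr_ge0 ?invr_ge0 ?(ltW s0) ?(ltW S0)// lerD2l.
  rewrite ler_pdivrMr ?ltr_wpDl// ler_peMr ?lerDr//.
  by rewrite mulr_ge0 ?exprn_ge0 ?(ltW e0)// ltW// binom_coef_gt0.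
have fX : limn (series (f e)) @[e --> 1^'-] --> C^-1 * X.
  have CfX : C * limn (series (f e)) @[e --> 1^'-] --> X.
    apply: (@cvg_dist_le _ _ _ _ (fun e => 2 * (s^-1 * S) * ((1 + s^-1) * (1 - e) / (1 + 1) + 0))).
      near=> e; apply: lim_err; apply/andP; split; near: e.
        exact: nbhs_left_gt.
      exact: nbhs_left_lt.
    rewrite [X in _ --> X](_ : 0 =
      2 * (s^-1 * S) * ((1 + s^-1) * (1 - 1) / (1 + 1) + 0)); last first.
      by rewrite subrr mulr0 mul0r addr0 mulr0.
    apply: cvg_at_left_filter; apply: cvgMl_tmp; apply: cvgD; last exact: cvg_cst.
    by apply: cvgMr_tmp; apply: cvgMl_tmp; apply: cvgB; [exact: cvg_cst|exact: cvg_id].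
  rewrite (_ : (fun e => limn (series (f e))) =
    fun e => C^-1 * (C * limn (series (f e)))); first exact: cvgMl_tmp.
  by apply/funext => e; rewrite mulKf// gt_eqF.
split.
  split; first by move=> e /fcvg.
  by apply/cvg_ex; exists (C^-1 * X).
rewrite /L_minus /abel_sum -/S (cvg_lim _ fX)//; congr EFin.
rewrite /C opprB; field; by rewrite ?mulN1r (gt_eqF sm1) (gt_eqF S0).
Unshelve. all: by end_near. Qed.

End perimeter_series.

Unset Implicit Arguments.
Set Strict Implicit.

Theorem theorem4p1 (R : realType) (s a b : R)
    (s_gt0 : 0 < s) (s_neq1 : s != 1) (b_gt0 : 0 < b) (b_le_a : b <= a) :
  let zb := b ^+ 2 / (a ^+ 2 + b ^+ 2) in
  let za := a ^+ 2 / (a ^+ 2 + b ^+ 2) in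
  [/\ perimeter s a b = perimeter s b a,
      1 < s ->
        cvgn (series (perimeter_term (u_plus s) s a b)) /\
        perimeter s a b = (L_plus s a b)%:E,
      s < 1 ->
        abel_summable (perimeter_term (u_minus s) s a b) /\
        perimeter s a b = (L_minus s a b)%:E,
      [/\ 0 < zb, zb <= 2^-1, 2^-1 <= za & za < 1]
    & forall k : nat,
        (1 < s ->
           abs_cvg_gauss_series (- 2^-1) 1 (u_plus s k + 1) zb /\
           abs_cvg_gauss_series (- 2^-1) 1 (u_plus s k + 1) za) /\
        (s < 1 ->
           abs_cvg_gauss_series (- 2^-1) 1 (u_minus s k + 1) zb /\
           abs_cvg_gauss_series (- 2^-1) 1 (u_minus s k + 1) za)].
Proof.
move=> zb za; have a_gt0 : 0 < a := lt_le_trans b_gt0 b_le_a.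
have a2 : 0 < a ^+ 2 by rewrite exprn_gt0.
have b2 : 0 < b ^+ 2 by rewrite exprn_gt0.
have ab2 : b ^+ 2 <= a ^+ 2 by rewrite lerXn2r ?nnegrE ?(ltW a_gt0) ?(ltW b_gt0).
have ab0 : 0 < a ^+ 2 + b ^+ 2 by rewrite addr_gt0.
have zb0 : 0 < zb by rewrite divr_gt0.
have zb1 : zb <= 2^-1 by rewrite ler_pdivrMr//; lra.
have za1 : 2^-1 <= za by rewrite ler_pdivlMr//; lra.
have zalt1 : za < 1 by rewrite ltr_pdivrMr// mul1r ltrDl.
have zb01 : 0 <= zb < 1 by apply/andP; split; lra.
have za01 : 0 <= za < 1 by apply/andP; split; lra.
split.
- exact: perimeter_sym.
- by move=> s1; exact: cvg_perimeter_term_gt1.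
- by move=> s1; exact: abel_perimeter_term_lt1.
- by split.
- move=> k; split=> s1.
  + have u0 : 0 <= u_plus s k.
      by rewrite /u_plus divr_ge0 ?addr_ge0 ?mulr_ge0 ?subr_ge0 ?(ltW s_gt0) ?(ltW s1).
    by split; apply: abs_cvg_gauss_Nhalf1 => //; rewrite lerDr.
  + have u0 : 0 <= u_minus s k.
      by rewrite /u_minus divr_ge0 ?mulr_ge0 ?subr_ge0 ?(ltW s_gt0) ?(ltW s1).
    by split; apply: abs_cvg_gauss_Nhalf1 => //; rewrite lerDr.
Qed.
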